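(* For every $\alpha>1$ there exists a constant $C_1=C_1(\alpha)>0$ such that, for all sequences $(\gamma_0^{(n)})_{n\in\mathbb{N}}\in\mathcal{H}^\alpha$, for all $k\in\mathbb{N}$ and for all $j\in\{1,\dots,k\}$, one has $$\|S^{(k,\alpha)}B_{j,k+1}\,\mathcal{U}^{(k+1)}(t)\gamma_0^{(k+1)}\|_{L^2([0,2\pi]\times\Lambda^k\times\Lambda^k)}\le C_1\|S^{(k+1,\alpha)}\gamma_0^{(k+1)}\|_{L^2(\Lambda^{k+1}\times\Lambda^{k+1})}.$$
   Context: $\Lambda=\mathbb{T}^3=(\mathbb{R}/2\pi\mathbb{Z})^3$; $\vec{x}_k=(x_1,\dots,x_k)$, $\vec{x}_k'=(x_1',\dots,x_k')$ with $x_j,x_j'\in\Lambda$. All $k$-particle density matrices $\gamma_0^{(k)}:\Lambda^k\times\Lambda^k\to\mathbb{C}$ satisfy $\gamma_0^{(k)}(\vec{x}_k;\vec{x}_k')=\overline{\gamma_0^{(k)}(\vec{x}_k';\vec{x}_k)}$ and $\gamma_0^{(k)}(x_{\sigma(1)},\dots,x_{\sigma(k)};x'_{\sigma(1)},\dots,x'_{\sigma(k)})=\gamma_0^{(k)}(\vec{x}_k;\vec{x}_k')$ for all $\sigma\in S_k$. Fourier transform: $(\gamma_0^{(k)})^{\wedge}(\vec{n}_k;\vec{n}_k')=\int_{\Lambda^k\times\Lambda^k}\gamma_0^{(k)}(\vec{x}_k;\vec{x}_k')e^{-i\sum_j\langle x_j,n_j\rangle+i\sum_j\langle x_j',n_j'\rangle}d\vec{x}_kd\vec{x}_k'$,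 with $\vec{n}_k,\vec{n}_k'\in(\mathbb{Z}^3)^k$. $S^{(k,\alpha)}=\prod_{j=1}^k(1-\Delta_{x_j})^{\alpha/2}(1-\Delta_{x_j'})^{\alpha/2}$. A sequence $(\gamma_0^{(k)})_k$ of $k$-particle density matrices belongs to $\mathcal{H}^\alpha$ if $\|S^{(k,\alpha)}\gamma_0^{(k)}\|_{L^2(\Lambda^k\times\Lambda^k)}<\infty$ for all $k$. Free evolution: $\mathcal{U}^{(k)}(t)\gamma_0^{(k)}=e^{it\sum_{j=1}^k\Delta_{x_j}}\gamma_0^{(k)}e^{-it\sum_{j=1}^k\Delta_{x_j'}}$, i.e. multiplication of $(\gamma_0^{(k)})^\wedge(\vec{n}_k;\vec{n}_k')$ by $e^{-it(|\vec{n}_k|^2-|\vec{n}_k'|^2)}$. Collision operator: for $1\le j\le k$, $B_{j,k+1}=B^+_{j,k+1}-B^-_{j,k+1}$, where $$B^{+}_{j,k+1}(\gamma_0^{(k+1)})(\vec{x}_k;\vec{x}_k')=\int_\Lambda \delta(x_j-x_{k+1})\,\gamma_0^{(k+1)}(\vec{x}_k,x_{k+1};\vec{x}_k',x_{k+1})\,dx_{k+1},$$ $$B^{-}_{j,k+1}(\gamma_0^{(k+1)})(\vec{x}_k;\vec{x}_k')=\int_\Lambda \delta(x_j'-x_{k+1})\,\gamma_0^{(k+1)}(\vec{x}_k,x_{k+1};\vec{x}_k',x_{k+1})\,dx_{k+1}.$$ These are understood through Fourier series; e.g., up to an absolute normalizing constant, $(B^+_{1,k+1}\gamma_0^{(k+1)})^\wedge(\vec{n}_k;\vec{n}_k')=\sum_{n_{k+1},n_{k+1}'\in\mathbb{Z}^3}(\gamma_0^{(k+1)})^\wedge(n_1-n_{k+1}+n_{k+1}',n_2,\dots,n_{k+1};n_1',\dots,n_{k+1}')$.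 *)

(* Defs.v *)
From HB Require Import structures.
From mathcomp Require Import all_boot all_order all_algebra perm.
From mathcomp Require Import all_classical all_reals all_analysis.
From mathcomp Require Import complex.

Set Implicit Arguments.
Unset Strict Implicit.
Unset Printing Implicit Defensive.
Import Order.TTheory GRing.Theory Num.Theory.
Import numFieldNormedType.Exports.

Local Open Scope classical_set_scope.
Local Open Scope ring_scope.
Local Open Scope complex_scope.

(* The instance declaring [\x] finite in the library is restricted to
   subprobabilities. *)
Section finite_product_measure.
Context d1 d2 (T1 : measurableType d1) (T2 : measurableType d2) (R : realType).
Variables (mu : {finite_measure set T1 -> \bar R})
          (nu : {finite_measure set T2 -> \bar R}).

Definition finite_product : set (T1 * T2)%type -> \bar R := (mu \x nu)%E.

HB.instance Definition _ := Measure.on finite_product.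

Let finite_product_fin : fin_num_fun finite_product.
Proof.
move=> A mA; rewrite ge0_fin_numE//.
apply: (@le_lt_trans _ _ (finite_product setT)).
  by apply: le_measure => //; rewrite inE.
rewrite /finite_product -setXTT product_measure1E//.
by rewrite lte_mul_pinfty// ?fin_num_measure// -ge0_fin_numE ?fin_num_measure.
Qed.

HB.instance Definition _ := @Measure_isFinite.Build _ _ _
  finite_product finite_product_fin.
End finite_product_measure.

Section tuple_cons_measure.
Context d (T : measurableType d) (R : realType).
Variables (mu : {finite_measure set T -> \bar R}) (n : nat).
Variable nu : {finite_measure set (n.-tuple T) -> \bar R}.

Definition tuple_cons (p : T * n.-tuple T) : n.+1.-tuple T :=
  [tuple of p.1 :: p.2].

Lemma measurable_tuple_cons : measurable_fun setT tuple_cons.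
Proof. exact: (measurable_cons measurable_fst measurable_snd). Qed.

Definition tuple_cons_measure : set (n.+1.-tuple T) -> \bar R :=
  pushforward (finite_product mu nu) tuple_cons.

Let tuple_cons_measure0 : tuple_cons_measure set0 = 0%E.
Proof. by rewrite /tuple_cons_measure /pushforward preimage_set0 measure0. Qed.

Let tuple_cons_measure_ge0 A : (0 <= tuple_cons_measure A)%E.
Proof. exact: (measure_ge0 (finite_product mu nu)). Qed.

Let tuple_cons_measure_sigma_additive : semi_sigma_additive tuple_cons_measure.
Proof.
move=> F mF tF mUF; rewrite /tuple_cons_measure /pushforward preimage_bigcup.
apply: (@measure_semi_sigma_additive _ _ _ (finite_product mu nu)).
- by move=> i; rewrite -[X in measurable X]setTI; exact: measurable_tuple_cons.
- apply/trivIsetP => /= i j _ _ ij; rewrite -preimage_setI.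
  by move/trivIsetP : tF => /(_ _ _ _ _ ij) ->//; rewrite preimage_set0.
- rewrite -preimage_bigcup -[X in measurable X]setTI.
  exact: measurable_tuple_cons.
Qed.

HB.instance Definition _ := isMeasure.Build _ _ _ tuple_cons_measure
  tuple_cons_measure0 tuple_cons_measure_ge0 tuple_cons_measure_sigma_additive.

Let tuple_cons_measure_fin : fin_num_fun tuple_cons_measure.
Proof.
move=> A mA; apply: (fin_num_measure (finite_product mu nu)).
by rewrite -[X in measurable X]setTI; exact: measurable_tuple_cons.
Qed.

HB.instance Definition _ := @Measure_isFinite.Build _ _ _
  tuple_cons_measure tuple_cons_measure_fin.
End tuple_cons_measure.

Section tuple_nil_measure.
Context d (T : measurableType d) (R : realType).

Definition tuple_nil_measure : set (0.-tuple T) -> \bar R :=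
  @dirac _ (0.-tuple T) [tuple] R.
HB.instance Definition _ := FiniteMeasure.on tuple_nil_measure.
End tuple_nil_measure.

(* The n-fold product measure on n-tuples. *)
Fixpoint tuple_measure d (T : measurableType d) (R : realType)
    (mu : {finite_measure set T -> \bar R}) (n : nat) :
    {finite_measure set (n.-tuple T) -> \bar R} :=
  match n with
  | 0 => @tuple_nil_measure d T R
  | m.+1 => tuple_cons_measure mu (tuple_measure mu m)
  end.

Section period_measure.
Variable R : realType.

Definition period_measure : set (measurableTypeR R) -> \bar R :=
  mrestr lebesgue_measure (measurable_itv `[0, 2 * pi]).

HB.instance Definition _ := Measure.on period_measure.

Let period_measure_fin : fin_num_fun period_measure.
Proof.
move=> A mA; rewrite ge0_fin_numE//.
apply: (@le_lt_trans _ _ (lebesgue_measure (`[0, 2 * pi]%classic : set R))).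
  by apply: le_measure; rewrite ?inE//; exact: measurableI.
by rewrite /= lebesgue_measure_itv /=; case: ifP => _; rewrite ltry.
Qed.

HB.instance Definition _ := @Measure_isFinite.Build _ _ _
  period_measure period_measure_fin.
End period_measure.
Arguments period_measure : clear implicits.

(* A function on the torus (R/2piZ)^3 is given by its values on the
   fundamental domain [0, 2pi]^3; [torus_measure] is the Lebesgue measure of
   that domain, so that everything outside of it is negligible. *)
Definition torus (R : realType) := 3.-tuple (measurableTypeR R).

Definition torus_measure (R : realType) :
    {finite_measure set (torus R) -> \bar R} :=
  tuple_measure (period_measure R) 3.

Definition config (R : realType) (k : nat) := k.-tuple (torus R).

Definition config_measure (R : realType) (k : nat) :
    {finite_measure set (config R k) -> \bar R} :=
  tuple_measure (torus_measure R) k.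

Definition kernel_fun (R : realType) (k : nat) :=
  (config R k * config R k)%type -> R[i].

Definition kernel_measure (R : realType) (k : nat) :
    {finite_measure set (config R k * config R k)%type -> \bar R} :=
  finite_product (config_measure R k) (config_measure R k).

Definition spacetime_measure (R : realType) (k : nat) :
    {finite_measure
      set (measurableTypeR R * (config R k * config R k))%type -> \bar R} :=
  finite_product (period_measure R) (kernel_measure R k).

Section complex_functions.
Context d (T : measurableType d) (R : realType).
Variable mu : {measure set T -> \bar R}.
Implicit Type f : T -> R[i].

Definition cintegrable f :=
  mu.-integrable setT (fun x => (complex.Re (f x))%:E) /\
  mu.-integrable setT (fun x => (complex.Im (f x))%:E).

Definition cintegral f : R[i] :=
  (\int[mu]_x complex.Re (f x)) +i* (\int[mu]_x complex.Im (f x)).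

Definition L2norm f : \bar R :=
  Lnorm mu 2%:E (fun x => (Normc.normc (f x))%:E).

Definition memL2 f :=
  [/\ measurable_fun setT (fun x => complex.Re (f x)),
      measurable_fun setT (fun x => complex.Im (f x)) &
      (L2norm f < +oo)%E].
End complex_functions.

Section complex_series.
Variables (R : realType) (I : choiceType).

Definition csummable (u : I -> R[i]) :=
  summable [set: I] (fun i => (Normc.normc (u i))%:E).

Definition rsum (u : I -> R) : R :=
  fine (\esum_(i in [set: I]) (EFin \o u)^\+%E i) -
  fine (\esum_(i in [set: I]) (EFin \o u)^\-%E i).

(* The sum of an absolutely summable family. *)
Definition csum (u : I -> R[i]) : R[i] :=
  rsum (fun i => complex.Re (u i)) +i* rsum (fun i => complex.Im (u i)).
End complex_series.

Definition cis (R : realType) (a : R) : R[i] := cos a +i* sin a.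

Definition freq (k : nat) := k.-tuple 'rV[int]_3.

Definition dot3 (R : realType) (x : torus R) (n : 'rV[int]_3) : R :=
  \sum_(i < 3) tnth x i * (n 0 i)%:~R.

Definition dot (R : realType) (k : nat) (x : config R k) (n : freq k) : R :=
  \sum_(j < k) dot3 (tnth x j) (tnth n j).

Definition sqnorm3 (n : 'rV[int]_3) : int := \sum_(i < 3) n 0 i ^+ 2.

Definition sqnorm (k : nat) (n : freq k) : int :=
  \sum_(j < k) sqnorm3 (tnth n j).

(* Families of Fourier coefficients indexed by (n; n'). Operators that need not
   preserve functions are defined on these. *)
Definition fcoeff (R : realType) (k : nat) := freq k -> freq k -> R[i].

Definition fourier (R : realType) (k : nat) (f : kernel_fun R k) : fcoeff R k :=
  fun n n' => cintegral (kernel_measure R k)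
    (fun z => f z * cis (- dot z.1 n + dot z.2 n')).

(* The L^2 norm of the distribution on Lambda^k x Lambda^k with Fourier
   coefficients [c]: it is +oo if no L^2 function has these coefficients, and
   otherwise the infimum is over a single value, since an L^2 function is
   determined almost everywhere by its Fourier coefficients. *)
Definition L2norm_coeff (R : realType) (k : nat) (c : fcoeff R k) : \bar R :=
  ereal_inf [set L2norm (kernel_measure R k) f | f in
    [set f | memL2 (kernel_measure R k) f /\ fourier f = c]].

(* Same convention on [0, 2pi] x Lambda^k x Lambda^k, for a time-dependent
   distribution. *)
Definition L2norm_spacetime (R : realType) (k : nat) (c : R -> fcoeff R k) :
    \bar R :=
  ereal_inf [set L2norm (spacetime_measure R k) F | F in
    [set F | memL2 (spacetime_measure R k) F /\
      {ae period_measure R, forall t, fourier (fun z => F (t, z)) = c t}]].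

Definition bracket (R : realType) (alpha : R) (n : 'rV[int]_3) : R :=
  (1 + (sqnorm3 n)%:~R) `^ (alpha / 2).

Definition sobolev (R : realType) (k : nat) (alpha : R) (c : fcoeff R k) :
    fcoeff R k :=
  fun n n' => (\prod_(j < k) (bracket alpha (tnth n j) *
                              bracket alpha (tnth n' j)))%:C * c n n'.

Definition free_evolution (R : realType) (k : nat) (t : R) (c : fcoeff R k) :
    fcoeff R k :=
  fun n n' => cis (- t * (sqnorm n - sqnorm n')%:~R) * c n n'.

Definition shift_freq (k : nat) (j : 'I_k) (v : 'rV[int]_3) (n : freq k) :
    freq k :=
  [tuple if i == j then tnth n i + v else tnth n i | i < k].

Definition rcons_freq (k : nat) (n : freq k) (m : 'rV[int]_3) : freq k.+1 :=
  [tuple of rcons n m].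

(* Setting x_{k+1} = x'_{k+1} = x_j in the Fourier series
     gamma(x; x') = (2pi)^(-6(k+1)) \sum c(n; n') e^(i<x,n> - i<x',n'>)
   turns the factor in x_j into e^(i<x_j, n_j + n_{k+1} - n'_{k+1}>), and
   setting them equal to x'_j turns the factor in x'_j into
   e^(-i<x'_j, n'_j + n'_{k+1} - n_{k+1}>); below, p = (n_{k+1}, n'_{k+1}). *)
Definition collision_plus_term (R : realType) (k : nat) (j : 'I_k)
    (c : fcoeff R k.+1) (n n' : freq k) (p : 'rV[int]_3 * 'rV[int]_3) : R[i] :=
  c (rcons_freq (shift_freq j (p.2 - p.1) n) p.1) (rcons_freq n' p.2).

Definition collision_minus_term (R : realType) (k : nat) (j : 'I_k)
    (c : fcoeff R k.+1) (n n' : freq k) (p : 'rV[int]_3 * 'rV[int]_3) : R[i] :=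
  c (rcons_freq n p.1) (rcons_freq (shift_freq j (p.1 - p.2) n') p.2).

Definition collision_summable (R : realType) (k : nat) (j : 'I_k)
    (c : fcoeff R k.+1) :=
  forall n n' : freq k, csummable (collision_plus_term j c n n') /\
                        csummable (collision_minus_term j c n n').

(* (2pi)^(-6) = (2pi)^(6k) (2pi)^(-6(k+1)). *)
Definition collision_plus (R : realType) (k : nat) (j : 'I_k)
    (c : fcoeff R k.+1) : fcoeff R k :=
  fun n n' => ((2 * pi) ^- 6)%:C * csum (collision_plus_term j c n n').

Definition collision_minus (R : realType) (k : nat) (j : 'I_k)
    (c : fcoeff R k.+1) : fcoeff R k :=
  fun n n' => ((2 * pi) ^- 6)%:C * csum (collision_minus_term j c n n').

Definition collision (R : realType) (k : nat) (j : 'I_k) (c : fcoeff R k.+1) :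
    fcoeff R k :=
  fun n n' => collision_plus j c n n' - collision_minus j c n n'.

Definition permute (R : realType) (k : nat) (s : 'S_k) (x : config R k) :
    config R k :=
  [tuple tnth x (s i) | i < k].

Definition density_matrix (R : realType) (k : nat) (f : kernel_fun R k) :=
  [/\ cintegrable (kernel_measure R k) f,
      {ae kernel_measure R k, forall z, f z = conjc (f (z.2, z.1))} &
      forall s : 'S_k, {ae kernel_measure R k, forall z,
        f (permute s z.1, permute s z.2) = f z}].

(* Only the members of the sequence with k >= 1 matter. *)
Definition Hspace (R : realType) (alpha : R)
    (gamma : forall k : nat, kernel_fun R k) :=
  forall k : nat, (0 < k)%N ->
    density_matrix (gamma k) /\
    (L2norm_coeff (sobolev alpha (fourier (gamma k))) < +oo)%E.

(* Main.v *)
Require Import Defs.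
From mathcomp Require Import all_boot all_order all_algebra.
From mathcomp Require Import all_classical all_reals all_analysis.
From mathcomp Require Import measurable_realfun complex zify ring lra.
From mathcomp Require finmap.

(** The estimate is an estimate on Fourier coefficients. Let c be the
    coefficients of gamma^(k+1) and d = S^(k+1,alpha) c; Bessel's inequality
    ([bessel]) bounds the sum of |d|^2 by a multiple of the right-hand side.
    Both S B^+ U(t) gamma and S B^- U(t) gamma are series of terms
      r d(N; N') e^(-i t m) e^(i<x,n> - i<x',n'>),    m = |N|^2 - |N'|^2,
    indexed by the output frequency (n; n') and by the pair (p, q) summed in the
    collision operator, where (N; N') is the frequency of gamma^(k+1) that the
    collision reads and r is a quotient of Sobolev weights. For B^+,
      r = <n_j>^alpha / (<a>^alpha <b>^alpha <c>^alpha)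
    with a = n_j + q - p, b = p, c = q, hence n_j = a + b - c; for B^- the roles
    of n and n', and of p and q, are exchanged.

    Terms with different (m, n, n') are orthogonal on [0, 2pi] x Lambda^k x
    Lambda^k. By Schur's test ([trig_schur]) the square of the norm is at most
    the sum of |d|^2 times the largest sum of r^2 over a class of terms with the
    same (m, n, n'). On such a class |a|^2 + |b|^2 - |c|^2 is fixed, so everything
    rests on [resonant_lattice_sum]: for alpha > 1,
      sum of r^2 over a + b - c = n, |a|^2 + |b|^2 - |c|^2 = tau
    is bounded uniformly in n and tau.

    That bound is proved as follows. With u = a - n and v = b - n one has
    c = n + u + v, and the second constraint says that u.v = kappa is fixed.
    If u = 0 or v = 0, two of a, b, c coincide, the third is n, and r^2 is
    <b>^(-4 alpha) or <a>^(-4 alpha), a convergent sum over Z^3. Otherwise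
    <n>^(2 alpha) is at most a constant times <a>^(2 alpha) + <b>^(2 alpha) +
    <c>^(2 alpha), which cancels one of the three factors and leaves the weights
    of two of a, b, c. The weight <X>^(-2 alpha) is split into one power of
    1 + X_i^2 per coordinate. If u_i v_i = mu is nonzero for some coordinate i,
    that coordinate receives a small exponent eta and the two others exponents
    larger than 1/2, which is possible because alpha > 1. The two other
    coordinates are then summed without any constraint, and the sum over
    u_i v_i = mu is bounded by the divisor bound ([one_coordinate_sum]). If
    u_i v_i = 0 for every i, only three coordinates of (u, v) are free, at most
    two of them belonging to the same vector ([resonant_split]).

    The left-hand norm is an infimum over functions having the prescribed
    coefficients for almost every time, so such a function has to be produced.
    It is the limit of partial sums whose increments have geometrically small
    energy; on almost every time slice these partial sums are dominated by an
    integrable function, which identifies the coefficients of the limit there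
    ([tensor_series]). *)

Set Implicit Arguments.
Unset Strict Implicit.
Unset Printing Implicit Defensive.
Import Order.TTheory GRing.Theory Num.Theory.
Import numFieldNormedType.Exports.

Local Open Scope ring_scope.

Local Notation Z3 := 'rV[int]_3.

(** * Sums bounded uniformly over finite sets of indices *)

(** Convergence of a nonnegative series and an upper bound on its sum are
    expressed together through its finite partial sums, so that all estimates
    on lattice sums are about finite sums of reals. *)
Definition sums_le (R : realType) (I : eqType) (f : I -> R) (C : R) :=
  forall s : seq I, uniq s -> \sum_(i <- s) f i <= C.

Section sums_le_theory.
Variable R : realType.

Lemma ler_sum_subset (I : eqType) (f : I -> R) (s t : seq I) :
  (forall i, 0 <= f i) -> uniq s -> {subset s <= t} ->
  \sum_(i <- s) f i <= \sum_(i <- t) f i.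
Proof.
move=> f0; elim: s t => [|x s IH] t /=; first by rewrite big_nil sumr_ge0.
move=> /andP[xs us] st; have xt : x \in t by rewrite st ?mem_head.
rewrite big_cons (perm_big _ (perm_to_rem xt)) big_cons lerD2l.
apply: IH => // i iS; have := st i; rewrite inE iS orbT => /(_ isT).
rewrite (perm_mem (perm_to_rem xt)) inE => /orP[/eqP ix|//].
by rewrite -ix iS in xs.
Qed.

Section basic.
Variable I : eqType.
Implicit Types f g : I -> R.

Lemma sums_le_ge0 f C : sums_le f C -> 0 <= C.
Proof. by move=> /(_ [::] isT); rewrite big_nil. Qed.

Lemma sums_le_mono f g C : (forall i, f i <= g i) -> sums_le g C -> sums_le f C.
Proof. by move=> fg gC s us; apply: le_trans (gC s us); exact: ler_sum. Qed.

Lemma sums_le_weaken f C D : C <= D -> sums_le f C -> sums_le f D.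
Proof. by move=> CD fC s us; apply: le_trans (fC s us) CD. Qed.

Lemma sums_leD f g C D : sums_le f C -> sums_le g D -> sums_le (fun i => f i + g i) (C + D).
Proof. by move=> fC gD s us; rewrite big_split lerD ?fC ?gD. Qed.

Lemma sums_leZ k f C : 0 <= k -> sums_le f C -> sums_le (fun i => k * f i) (k * C).
Proof. by move=> k0 fC s us; rewrite -mulr_sumr ler_wpM2l ?fC. Qed.

Lemma sums_le_count (P : pred I) f (w N : R) :
  0 <= w -> (forall i, P i -> f i <= w) ->
  (forall s, uniq s -> all P s -> (size s)%:R <= N) ->
  sums_le (fun i => if P i then f i else 0) (N * w).
Proof.
move=> w0 fw sN s us; rewrite -big_mkcond -big_filter.
apply: (@le_trans _ _ (\sum_(i <- [seq i <- s | P i]) w)).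
  by rewrite big_seq [leRHS]big_seq; apply: ler_sum => i; rewrite mem_filter => /andP[/fw].
rewrite big_const_seq count_predT iter_addr_0 -mulr_natl ler_wpM2r//.
by apply: sN; [exact: filter_uniq|exact: filter_all].
Qed.
End basic.

(** Reindexing along a map that is injective only where the term does not
    vanish: this is how a constraint removes free variables. *)
Lemma sums_le_inj (I J : eqType) (P : pred J) (h : J -> I) (f : I -> R) C :
  (forall i, 0 <= f i) -> {in P &, injective h} -> sums_le f C ->
  sums_le (fun j => if P j then f (h j) else 0) C.
Proof.
move=> f0 hi fC s us; rewrite -big_mkcond -big_filter.
rewrite -(big_map h xpredT f); apply: fC.
rewrite map_inj_in_uniq ?filter_uniq// => i j.
by rewrite !mem_filter => /andP[Pi _] /andP[Pj _]; exact: hi.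
Qed.

Lemma sums_le_injT (I J : eqType) (h : J -> I) (f : I -> R) C :
  injective h -> sums_le f C -> sums_le (fun j => f (h j)) C.
Proof.
move=> hi fC s us; rewrite -(big_map h xpredT f); apply: fC.
by rewrite map_inj_uniq.
Qed.

(** Tonelli for finite sums. The inner family may depend on the outer index as
    long as its bound does not. *)
Lemma sums_le_prod (I J : eqType) (f : I -> R) (g : I -> J -> R) C D :
  (forall i, 0 <= f i) -> (forall i j, 0 <= g i j) -> 0 <= D ->
  sums_le f C -> (forall i, sums_le (g i) D) ->
  sums_le (fun p : I * J => f p.1 * g p.1 p.2) (C * D).
Proof.
move=> f0 g0 D0 fC gD s us.
pose si := undup (map fst s); pose sj := undup (map snd s).
apply: (@le_trans _ _ (\sum_(p <- [seq (i, j) | i <- si, j <- sj]) f p.1 * g p.1 p.2)).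
  apply: ler_sum_subset => //; first by move=> p; exact: mulr_ge0.
  move=> [i j] ps; apply/allpairsP; exists (i, j); split=> //=.
    by rewrite mem_undup; apply/mapP; exists (i, j).
  by rewrite mem_undup; apply/mapP; exists (i, j).
rewrite big_allpairs_dep /=.
apply: (@le_trans _ _ (\sum_(i <- si) f i * D)).
  apply: ler_sum => i _; rewrite -mulr_sumr ler_wpM2l//.
  by apply: gD; exact: undup_uniq.
by rewrite -mulr_suml ler_wpM2r//; apply: fC; exact: undup_uniq.
Qed.

End sums_le_theory.

(** * Weights on the integers *)

Section integer_sums.
Variable R : realType.

Lemma ler_powRN (a b th : R) : 0 <= th -> 0 < a -> a <= b -> b `^ (- th) <= a `^ (- th).
Proof.
move=> th0 a0 ab; have b0 : 0 < b by exact: lt_le_trans ab.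
rewrite !powRN lef_pV2 ?posrE ?powR_gt0//.
by rewrite ge0_ler_powR ?nnegrE// ltW.
Qed.

Definition int_weight (th : R) (s : int) : R := (1 + s%:~R ^+ 2) `^ (- th).

Lemma int_weight_base_ge1 (s : int) : 1 <= 1 + s%:~R ^+ 2 :> R.
Proof. by rewrite lerDl sqr_ge0. Qed.

Lemma int_weight_ge0 th s : 0 <= int_weight th s.
Proof. exact: powR_ge0. Qed.

Lemma int_weight_le1 th s : 0 <= th -> int_weight th s <= 1.
Proof.
move=> th0; rewrite -(powRr0 (1 + s%:~R ^+ 2)) ler_powR ?int_weight_base_ge1//.
by rewrite oppr_le0.
Qed.

(** Dyadic condensation: a block [2^K, 2^(K+1)) contributes at most
    2^K (4^K)^(-th) = x^K, with x < 1 exactly because th > 1/2. *)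
Lemma nat_weight_sum th : 2^-1 < th ->
  exists C, sums_le (fun n : nat => int_weight th n%:Z) C.
Proof.
move=> th2; have th0 : 0 < th by lra.
pose x : R := 2 * 4 `^ (- th).
have x0 : 0 <= x by rewrite mulr_ge0 ?powR_ge0.
have x1 : x < 1.
  have -> : x = 2 `^ (1 - 2 * th).
    rewrite powRD ?implybE ?pnatr_eq0 ?orbT// powRr1//; congr (_ * _).
    have -> : 4 = 2 `^ 2 :> R by rewrite powR_mulrn//; ring.
    by rewrite -powRrM mulrN.
  have h : 0 < 2 * th - 1 by lra.
  rewrite -opprB powRN invf_lt1 ?powR_gt0//.
  have := gt0_ltr_powR h (x := 1) (y := 2); rewrite !nnegrE powR1.
  by apply; rewrite ?ltr1n.
pose C : R := 1 + (1 - x)^-1.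
have SK K : \sum_(0 <= n < 2 ^ K) int_weight th n%:Z <= 1 + \sum_(k < K) x ^+ k.
  elim: K => [|K IH].
    by rewrite expn0 big_nat1 big_ord0 addr0 int_weight_le1// ltW.
  rewrite (@big_cat_nat _ _ _ (2 ^ K)) ?leq_exp2l//=.
  rewrite big_ord_recr/= addrA lerD//.
  apply: (@le_trans _ _ (\sum_(2 ^ K <= i < 2 ^ K.+1) (4 ^+ K) `^ (- th))).
    rewrite big_nat [leRHS]big_nat; apply: ler_sum => i /andP[Ki _].
    apply: (ler_powRN (ltW th0)); first exact: exprn_gt0.
    apply: (@le_trans _ _ (i%:R ^+ 2)); last by rewrite lerDr.
    have -> : 4 = 2 ^+ 2 :> R by ring.
    by rewrite -exprM mulnC exprM -natrX ler_pXn2r ?nnegrE ?ler_nat.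
  rewrite sumr_const_nat expnS mul2n -addnn addnK.
  rewrite -powR_mulrn// -powRrM mulrC powRrM powR_mulrn ?powR_ge0//.
  by rewrite /x exprMn -[leLHS]mulr_natl natrX.
exists C => s us.
pose K := (\max_(i <- s) i)%N.+1.
apply: (@le_trans _ _ (\sum_(0 <= n < 2 ^ K) int_weight th n%:Z)).
  apply: ler_sum_subset => // [i|i iS]; first exact: int_weight_ge0.
  rewrite mem_index_iota /=; apply: leq_trans (ltn_expl _ _) => //.
  rewrite ltnS /K leqW// (big_rem i iS) /=.
  exact: leq_maxl.
apply: le_trans (SK K) _; rewrite /C lerD2l.
have x1' : 0 < 1 - x by rewrite subr_gt0.
rewrite -(ler_pM2r x1') mulVf ?gt_eqF// mulrC -opprB mulNr -subrX1 opprB.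
by rewrite lerBlDr lerDl exprn_ge0.
Qed.

Lemma int_weight_abs th s : int_weight th s = int_weight th `|s|%N.
Proof.
have E : (`|s|%N : int) ^+ 2 = s ^+ 2 by rewrite abszE real_normK ?num_real.
by have := congr1 (fun z : int => z%:~R : R) E; rewrite !rmorphXn /int_weight => ->.
Qed.

Lemma int_weight_sum th : 2^-1 < th -> exists C, sums_le (int_weight th) C.
Proof.
move=> /nat_weight_sum[C hC]; exists (C + C).
apply: (@sums_le_mono _ _ _ (fun s => (if 0 <= s then int_weight th `|s|%N else 0) +
                                 (if s < 0 then int_weight th `|s|%N else 0))).
  by move=> s; rewrite -int_weight_abs; case: (ltP s 0) => _; rewrite ?addr0 ?add0r.
apply: sums_leD.
  apply: (sums_le_inj (P := fun s : int => 0 <= s) (h := absz) (f := fun n : nat => int_weight th n%:Z)) => //.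
    by move=> n; exact: int_weight_ge0.
  by move=> s t; rewrite /in_mem/=; lia.
apply: (sums_le_inj (P := fun s : int => s < 0) (h := absz) (f := fun n : nat => int_weight th n%:Z)) => //.
  by move=> n; exact: int_weight_ge0.
by move=> s t; rewrite /in_mem/=; lia.
Qed.
End integer_sums.

(** * The divisor bound *)

Section divisor_bound.
Local Open Scope nat_scope.

Lemma size_add_divisors f divs : size (PrimeDecompAux.add_divisors f divs) = f.2.+1 * size divs.
Proof.
case: f => p e /=; elim: e => [|e IH] /=; first by rewrite mul1n.
by rewrite size_merge size_cat size_map IH [RHS]mulSn addnC.
Qed.

Lemma size_divisors n : size (divisors n) = \prod_(f <- prime_decomp n) f.2.+1.
Proof.
rewrite /divisors; elim: (prime_decomp n) => [|f pd IH] /=; first by rewrite big_nil.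
by rewrite size_add_divisors IH big_cons.
Qed.

(** (e + 1)^k is at most (e + 1) ... (e + k) = k! binom(e + k, k), and a
    binomial coefficient of e + k is at most 2^(e + k). *)
Lemma expn_succ_le k e : e.+1 ^ k <= k`! * 2 ^ k * 2 ^ e.
Proof.
apply: (@leq_trans ((e + k) ^_ k)).
  rewrite ffact_prod -[X in _ ^ X]card_ord -prod_nat_const.
  by apply: leq_prod => i _; have := ltn_ord i; lia.
rewrite -bin_ffact mulnC -mulnA leq_mul2l; apply/orP; right.
rewrite -expnD addnC -[X in _ <= X ^ _]/(1 + 1) expnDn.
have h : k < (k + e).+1 by lia.
by rewrite (bigD1 (Ordinal h))//= !exp1n !muln1 leq_addr.
Qed.

(** The number of divisors is the product of e + 1 over the prime powers p^e
    of n. A prime p >= 2^k satisfies (e + 1)^k <= 2^(k e) <= p^e, and the fewer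
    than 2^k smaller primes cost a constant factor each. *)
Lemma size_divisors_le k : exists C, forall n, 0 < n -> size (divisors n) ^ k <= C * n.
Proof.
pose K := k`! * 2 ^ k.
have K0 : 0 < K by rewrite muln_gt0 fact_gt0 expn_gt0.
exists (K ^ (2 ^ k)) => n n0.
have key (f : nat * nat) : 1 < f.1 ->
    f.2.+1 ^ k <= (if f.1 < 2 ^ k then K else 1) * f.1 ^ f.2.
  case: f => p e /= p1; case: ltnP => pk.
    apply: leq_trans (expn_succ_le k e) _; rewrite leq_mul2l; apply/orP; right.
    by case: e => // e; rewrite leq_exp2r.
  rewrite mul1n; apply: (@leq_trans ((2 ^ k) ^ e)).
    rewrite -expnM mulnC expnM; case: k {K K0 pk} => // k.
    by rewrite leq_exp2r//; exact: ltn_expl.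
  by case: e => // e; rewrite leq_exp2r.
have keys (pd : seq (nat * nat)) : all (fun f => 1 < f.1) pd ->
    (\prod_(f <- pd) f.2.+1) ^ k <=
    K ^ count (fun f => f.1 < 2 ^ k) pd * \prod_(f <- pd) f.1 ^ f.2.
  elim: pd => [|f pd IH] /=; first by rewrite !big_nil exp1n.
  move=> /andP[f1 /IH h]; rewrite !big_cons expnMn expnD.
  have -> : K ^ (f.1 < 2 ^ k) = if f.1 < 2 ^ k then K else 1 by case: ifP.
  by rewrite mulnACA leq_mul// key.
have pr : all (fun f : nat * nat => 1 < f.1) (prime_decomp n).
  by apply/allP => -[p e] /mem_prime_decomp[/prime_gt1].
rewrite size_divisors; apply: leq_trans (keys _ pr) _.
rewrite -prod_prime_decomp// leq_mul2r leq_pexp2l ?orbT//.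
rewrite prime_decompE count_map -size_filter -[leqRHS](size_iota 0).
apply: uniq_leq_size; first by rewrite filter_uniq// primes_uniq.
by move=> p; rewrite mem_filter mem_iota /= => /andP[].
Qed.

End divisor_bound.

Lemma divisor_bound (R : realType) (eps : R) : 0 < eps ->
  exists2 C : R, 0 <= C & forall n : nat, (0 < n)%N ->
    (size (divisors n))%:R <= C * n%:R `^ eps.
Proof.
move=> e0.
have [k k1 ke] : exists2 k : nat, (0 < k)%N & k%:R^-1 <= eps.
  exists (Num.truncn eps^-1).+1 => //.
  rewrite invf_ple ?posrE// ltW//; apply: truncnS_gt.
have [C hC] := size_divisors_le k.
exists (C%:R `^ k%:R^-1) => [|n n0]; first exact: powR_ge0.
apply: (@le_trans _ _ ((C * n)%:R `^ k%:R^-1)).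
  have -> : (size (divisors n))%:R = ((size (divisors n))%:R `^ k%:R) `^ k%:R^-1 :> R.
    by rewrite -powRrM mulfV ?powRr1// pnatr_eq0 -lt0n.
  apply: ge0_ler_powR; rewrite ?nnegrE ?invr_ge0 ?powR_ge0//.
  by rewrite powR_mulrn// -natrX ler_nat hC.
rewrite natrM powRM// ler_wpM2l ?powR_ge0// ler_powR// ler1n//.
Qed.

(** * The equation u v = mu in one coordinate *)

Section one_coordinate.

(** In one coordinate, the resonance involves n + u together with n + v (for
    a and b) or with n + u + v (for a and c); the boolean selects which. *)
Definition second_freq (b : bool) (n u v : int) : int :=
  if b then n + u + v else n + v.

Lemma second_freq_inj b n u : injective (second_freq b n u).
Proof. by move=> v v'; rewrite /second_freq; case: b; lia. Qed.

Definition height b (n : int) (p : int * int) : int :=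
  1 + `|n + p.1| + `|second_freq b n p.1 p.2|.

Lemma height_ge b n p : 1 <= height b n p.
Proof. by rewrite /height -addrA lerDl addr_ge0. Qed.

Lemma ler_normM_height (M a c : int) : `|a| <= M -> `|c| <= M -> `|a * c| <= M ^+ 2.
Proof. by move=> aM cM; rewrite normrM expr2 ler_pM. Qed.

Lemma small_multiple (n d a c M N : int) : n * d = a - c -> `|a| <= M -> `|c| <= N ->
  2 * M < `|n| -> 2 * N < `|n| -> d = 0.
Proof.
move=> E aM cN Mn Nn; apply/eqP; apply/negP => /negP d0.
have d1 : 1 <= `|d| by rewrite -gtz0_ge1 normr_gt0.
have : `|n| <= `|a - c| by rewrite -E normrM ler_peMr.
have := ler_normB a c; lia.
Qed.

(** When |n| is much larger than the square of the two frequencies, u v = mu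
    leaves at most two solutions. For the frequencies X = n + u, Y = n + v this
    is because two solutions satisfy
      n (X' + Y' - X - Y) = X' Y' - X Y,
    a multiple of n smaller than n, hence zero: sum and product agree. For
    Y = n + u + v the same argument applies to n (v - v') = X v - X' v'. *)
Lemma far_rigidity b n (p p' : int * int) : p.1 * p.2 = p'.1 * p'.2 ->
  p.1 * p.2 != 0 ->
  2 * height b n p ^+ 2 < `|n| -> 2 * height b n p' ^+ 2 < `|n| ->
  p' = p \/ p' = (p.2, p.1).
Proof.
case: p p' => [u v] [u' v'] /= E nz.
rewrite /height /second_freq /=.
case: b => h h'.
  left; have vv : v - v' = 0.
    apply: (@small_multiple n _ ((n + u) * v) ((n + u') * v') _ _ _ _ _ h h').
    - by move: E; lia.
    - by apply: ler_normM_height; lia.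
    - by apply: ler_normM_height; lia.
  have v0 : v != 0 by apply: contraNneq nz => ->; rewrite mulr0.
  have {}vv : v' = v by lia.
  by rewrite vv; congr (_, _); apply: (mulIf v0); rewrite -{1}vv E.
have ss : u' + v' - (u + v) = 0.
  apply: (@small_multiple n _ ((n + u') * (n + v')) ((n + u) * (n + v)) _ _ _ _ _ h' h).
  - by move: E; lia.
  - by apply: ler_normM_height; lia.
  - by apply: ler_normM_height; lia.
have sE : v' = u + v - u' by lia.
have : (u' - u) * (u' - v) = 0.
  by move: E; rewrite sE; lia.
move/eqP; rewrite mulf_eq0 => /orP[] /eqP h0; [left|right]; congr (_, _); lia.
Qed.

(** Conversely, if |n| is not that large then mu is polynomially bounded in
    the size of the frequencies, so that any negative power of these beats the
    number of divisors of mu. *)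
Lemma near_bound b n (p : int * int) : `|n| <= 2 * height b n p ^+ 2 ->
  `|p.1 * p.2| <= 9 * height b n p ^+ 4.
Proof.
case: p => u v /=; set M := height b n (u, v) => nM.
have M1 : 1 <= M := height_ge _ _ _.
have MM : M <= M ^+ 2 by rewrite expr2 ler_peMr//; lia.
have -> : 9 * M ^+ 4 = (3 * M ^+ 2) ^+ 2 by ring.
apply: ler_normM_height; move: nM MM; rewrite /M /height /second_freq /=;
  set W := (_ ^+ 2); case: b @M M1 W; lia.
Qed.

Section weights.
Variable R : realType.

Lemma height_weight b n p :
  ((height b n p)%:~R ^+ 2 : R) <= 3 * ((1 + (n + p.1)%:~R ^+ 2) *
     (1 + (second_freq b n p.1 p.2)%:~R ^+ 2)).
Proof.
have -> : (height b n p)%:~R = 1 + `|(n + p.1)%:~R| +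
    `|(second_freq b n p.1 p.2)%:~R| :> R.
  rewrite /height; move: (n + p.1) (second_freq _ _ _ _) => x y; by rewrite !intrD !intr_norm.
set x := (n + p.1)%:~R : R; set y := (second_freq _ _ _ _)%:~R : R.
rewrite -(real_normK (num_real x)) -(real_normK (num_real y)).
move: `|x| `|y| => a c.
have := sqr_ge0 (a - c); have := sqr_ge0 (a - 1); have := sqr_ge0 (c - 1).
have := sqr_ge0 (a * c); nra.
Qed.

Lemma pairs_count (mu : int) (s : seq (int * int)) : mu != 0 -> uniq s ->
  all (fun p => p.1 * p.2 == mu) s -> (size s <= 2 * size (divisors `|mu|))%N.
Proof.
move=> mu0 us /allP smu.
have mup : (0 < `|mu|)%N by rewrite absz_gt0.
have i1 : {in s &, injective fst}.
  move=> [u v] [u' v'] /smu /= /eqP e1 /smu /= /eqP e2 uu.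
  rewrite -{}uu in e2 *; congr (_, _).
  have u0 : u != 0 by apply: contraNneq mu0 => u0; rewrite -e1 u0 mul0r.
  by apply: (mulfI u0); rewrite e1 e2.
rewrite -(size_map fst) mul2n -addnn.
pose D := divisors `|mu|.
rewrite -[X in (_ <= X + _)%N](size_map Posz) -[X in (_ <= _ + X)%N](size_map (fun d => - d%:Z)).
rewrite -size_cat; apply: uniq_leq_size; first by rewrite map_inj_in_uniq.
move=> u /mapP[[u' v] /smu /= /eqP E ->]; rewrite mem_cat.
have ud : `|u'|%N \in D.
  by rewrite -dvdn_divisors// -E abszM dvdn_mulr.
apply/orP; case: (leP 0 u') => u0; [left|right]; apply/mapP; exists `|u'|%N => //; lia.
Qed.

(** Uniform in n and mu. Far solutions number at most two and weigh at most 1;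
    near solutions number O(mu^(eta/2)) by the divisor bound and weigh
    O(mu^(-eta/2)) each. *)
Lemma one_coordinate_sum (eta : R) : 0 < eta -> exists2 C : R, 0 <= C &
  forall b n mu, mu != 0 -> sums_le (fun p : int * int =>
    if p.1 * p.2 == mu
    then int_weight eta (n + p.1) * int_weight eta (second_freq b n p.1 p.2) else 0) C.
Proof.
move=> eta0; have e2 : 0 < eta / 2 by rewrite divr_gt0.
have [K K0 hK] := divisor_bound e2.
exists (2 * K * 81 `^ (eta / 2) + 2) => [|b n mu mu0].
  by rewrite addr_ge0// !mulr_ge0// powR_ge0.
pose f (p : int * int) := int_weight eta (n + p.1) * int_weight eta (second_freq b n p.1 p.2).
pose near (p : int * int) := (p.1 * p.2 == mu) && (`|n| <= 2 * height b n p ^+ 2).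
pose far (p : int * int) := (p.1 * p.2 == mu) && (2 * height b n p ^+ 2 < `|n|).
have f1 p : f p <= 1 by rewrite mulr_ile1 ?int_weight_ge0 ?int_weight_le1// ltW.
apply: (@sums_le_mono _ _ _ (fun p => (if near p then f p else 0) + (if far p then f p else 0))).
  move=> p; rewrite /near /far -/(f p).
  by case: (p.1 * p.2 == mu) => /=; rewrite ?addr0//; case: leP; rewrite ?addr0 ?add0r.
apply: sums_leD; last first.
  rewrite -[2]mulr1; apply: sums_le_count => // s us /allP sfar.
  case: s us sfar => [|p s] us sfar; first by rewrite ler0n.
  rewrite ler_nat.
  apply: (@uniq_leq_size _ (p :: s) [:: p; (p.2, p.1)]) => // p' p's.
  have /andP[/eqP pm pn] := sfar p (mem_head _ _).
  have /andP[/eqP pm' pn'] := sfar p' p's.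
  have [||->|->] := @far_rigidity b n p p' _ _ pn pn'; rewrite ?inE ?eqxx ?orbT//.
    by rewrite pm pm'.
  by rewrite pm.
pose m : R := `|mu|%N%:R.
have m0 : 0 < m by rewrite ltr0n absz_gt0.
rewrite (_ : 2 * K * _ = (2 * (K * m `^ (eta / 2))) * (81 `^ (eta / 2) * m `^ (- (eta / 2)))); last first.
  by rewrite powRN; field; rewrite gt_eqF ?powR_gt0.
apply: sums_le_count; first by rewrite mulr_ge0 ?powR_ge0.
  move=> p /andP[/eqP pm /near_bound]; rewrite pm => mM.
  have := height_weight b n p.
  rewrite /f /int_weight -powRM; try by apply: le_trans ler01 (int_weight_base_ge1 _ _).
  set W := (1 + _) * (1 + _) => hW.
  have W0 : 0 < W by apply: mulr_gt0; apply: lt_le_trans (ltr01) _; exact: int_weight_base_ge1.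
  (* height^2 <= 3 W and |mu| <= 9 height^4 give |mu| <= 81 W^2. *)
  have mW : m / 81 <= W ^+ 2.
    rewrite ler_pdivrMr//.
    have h1 : m <= 9 * ((height b n p)%:~R ^+ 2) ^+ 2.
      have : (`|mu|%:~R : R) <= (9 * height b n p ^+ 4)%:~R by rewrite ler_int.
      by rewrite intrM (rmorphXn (intmul 1)) /m natr_absz -exprM.
    have h2 : ((height b n p)%:~R ^+ 2) ^+ 2 <= (3 * W) ^+ 2.
      by rewrite ler_pXn2r// nnegrE; [exact: sqr_ge0|exact: mulr_ge0 (ltW W0)].
    move: h1 h2; rewrite exprMn; lra.
  have -> : W `^ (- eta) = (W ^+ 2) `^ (- (eta / 2)).
    by rewrite -powR_mulrn ?(ltW W0)// -powRrM; congr (_ `^ _); field.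
  have m81 : 0 < m / 81 by rewrite divr_gt0.
  apply: le_trans (ler_powRN (ltW e2) m81 mW) _.
  by rewrite powRM ?invr_ge0 ?(ltW m0)// mulrC -powR_inv1// -powRrM mulN1r opprK.
move=> s us snear.
apply: (@le_trans _ _ (2 * size (divisors `|mu|))%:R).
  rewrite ler_nat; apply: pairs_count => //.
  by apply: sub_all snear => p /andP[].
by rewrite natrM ler_pM2l// hK// absz_gt0.
Qed.
End weights.
End one_coordinate.

(** * The equation u.v = kappa in three coordinates *)

Section three_coordinates.
Variable R : realType.

Definition int3_weight (al : R) (x0 x1 x2 : int) : R :=
  (1 + x0%:~R ^+ 2 + x1%:~R ^+ 2 + x2%:~R ^+ 2) `^ (- al).

Lemma int3_weight_ge0 al x0 x1 x2 : 0 <= int3_weight al x0 x1 x2. Proof. exact: powR_ge0. Qed.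

(** A negative power of 1 + |x|^2 may be distributed over the three
    coordinates in any proportion. *)
Lemma int3_weight_le (al t0 t1 t2 : R) x0 x1 x2 : 0 <= t0 -> 0 <= t1 -> 0 <= t2 ->
  t0 + t1 + t2 <= al -> int3_weight al x0 x1 x2 <= int_weight t0 x0 * int_weight t1 x1 * int_weight t2 x2.
Proof.
move=> h0 h1 h2 hal; rewrite /int3_weight.
set N := 1 + _ + _ + _.
have s0 := sqr_ge0 (x0%:~R : R); have s1 := sqr_ge0 (x1%:~R : R).
have s2 := sqr_ge0 (x2%:~R : R).
have N1 : 1 <= N by rewrite /N -!addrA lerDl !addr_ge0.
apply: (@le_trans _ _ (N `^ (- (t0 + t1 + t2)))).
  by rewrite ler_powR// lerN2.
have Nn0 : N != 0 by rewrite gt_eqF// (lt_le_trans ltr01).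
rewrite !opprD !powRD ?Nn0 ?implybT//.
rewrite !ler_pM ?mulr_ge0 ?powR_ge0// /int_weight; apply: ler_powRN => //;
  try (apply: lt_le_trans ltr01 _; exact: int_weight_base_ge1); rewrite /N; lra.
Qed.

Variable al : R.
Hypothesis al1 : 1 < al.
Let th : R := (1 + al) / 4.
Let eta : R := (al - 1) / 2.
Let th0 : 0 <= th. Proof. rewrite /th; move: al1; lra. Qed.
Let eta0 : 0 <= eta. Proof. rewrite /eta; move: al1; lra. Qed.

Local Notation P := (int * int)%type.

Definition pair_wt (t : R) b (n : int) (p : P) : R :=
  int_weight t (n + p.1) * int_weight t (second_freq b n p.1 p.2).

(** Dominates the part of the weight carried by a coordinate where u v = 0:
    the free variable is u (when v = 0), seen in n + u, or v (when u = 0), seen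
    in the second frequency. *)
Definition degenerate_wt b (n : int) (p : P) : R :=
  (if p.2 == 0 then int_weight th (n + p.1) else 0) +
  (if p.1 == 0 then int_weight th (second_freq b n p.1 p.2) else 0).

(** The last coordinate is the one where u v does not vanish; its product is
    determined by the two others. *)
Definition nondegenerate_wt b (n0 n1 n2 ka : int) (p : (P * P) * P) : R :=
  pair_wt th b n0 p.1.1 * pair_wt th b n1 p.1.2 *
  (if (ka - p.1.1.1 * p.1.1.2 - p.1.2.1 * p.1.2.2 != 0) &&
      (p.2.1 * p.2.2 == ka - p.1.1.1 * p.1.1.2 - p.1.2.1 * p.1.2.2)
   then pair_wt eta b n2 p.2 else 0).

Definition resonant_wt b (n0 n1 n2 ka : int) (p : (P * P) * P) : R :=
  let: (p0, p1, p2) := p in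
  if [&& p0.1 * p0.2 + p1.1 * p1.2 + p2.1 * p2.2 == ka,
         [|| p0.1 != 0, p1.1 != 0 | p2.1 != 0] &
         [|| p0.2 != 0, p1.2 != 0 | p2.2 != 0]]
  then int3_weight al (n0 + p0.1) (n1 + p1.1) (n2 + p2.1) *
       int3_weight al (second_freq b n0 p0.1 p0.2) (second_freq b n1 p1.1 p1.2)
             (second_freq b n2 p2.1 p2.2)
  else 0.

Lemma pair_wt_ge0 t b n p : 0 <= pair_wt t b n p.
Proof. by rewrite mulr_ge0 ?int_weight_ge0. Qed.

Lemma degenerate_wt_ge0 b n p : 0 <= degenerate_wt b n p.
Proof. by apply: addr_ge0; case: ifP => // _; exact: int_weight_ge0. Qed.

Lemma nondegenerate_wt_ge0 b n0 n1 n2 ka p : 0 <= nondegenerate_wt b n0 n1 n2 ka p.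
Proof.
apply: mulr_ge0; first by apply: mulr_ge0; exact: pair_wt_ge0.
by case: ifP => // _; exact: pair_wt_ge0.
Qed.

Lemma int3_weight_prod_le t0 t1 t2 b x0 x1 x2 p0 p1 p2 : 0 <= t0 -> 0 <= t1 -> 0 <= t2 ->
  t0 + t1 + t2 <= al ->
  int3_weight al (x0 + p0.1) (x1 + p1.1) (x2 + p2.1) *
       int3_weight al (second_freq b x0 p0.1 p0.2) (second_freq b x1 p1.1 p1.2)
             (second_freq b x2 p2.1 p2.2) <=
  pair_wt t0 b x0 p0 * pair_wt t1 b x1 p1 * pair_wt t2 b x2 p2.
Proof.
move=> h0 h1 h2 hal; rewrite /pair_wt.
rewrite [leRHS](_ : _ = (int_weight t0 (x0 + p0.1) * int_weight t1 (x1 + p1.1) * int_weight t2 (x2 + p2.1)) *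
  (int_weight t0 (second_freq b x0 p0.1 p0.2) * int_weight t1 (second_freq b x1 p1.1 p1.2) *
   int_weight t2 (second_freq b x2 p2.1 p2.2))); last by ring.
by rewrite ler_pM ?int3_weight_ge0//; exact: int3_weight_le.
Qed.

(** Either some coordinate has u_i v_i nonzero, and one of the three
    nondegenerate weights dominates, or all the products vanish. In the latter
    case a coordinate is charged to the first frequency when v_i = 0 and to the
    second one otherwise. Since v is not 0 the first frequency is charged at most
    twice, and since u is not 0 so is the second: the exponent available to each
    is alpha >= 2 th. *)
Lemma resonant_split b n0 n1 n2 ka p0 p1 p2 :
  resonant_wt b n0 n1 n2 ka (p0, p1, p2) <=
  nondegenerate_wt b n0 n1 n2 ka (p0, p1, p2) +
  nondegenerate_wt b n0 n2 n1 ka (p0, p2, p1) +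
  nondegenerate_wt b n1 n2 n0 ka (p1, p2, p0) +
  degenerate_wt b n0 p0 * degenerate_wt b n1 p1 * degenerate_wt b n2 p2.
Proof.
have G1 := nondegenerate_wt_ge0 b n0 n1 n2 ka (p0, p1, p2).
have G2 := nondegenerate_wt_ge0 b n0 n2 n1 ka (p0, p2, p1).
have G3 := nondegenerate_wt_ge0 b n1 n2 n0 ka (p1, p2, p0).
have G4 : 0 <= degenerate_wt b n0 p0 * degenerate_wt b n1 p1 * degenerate_wt b n2 p2.
  by rewrite !mulr_ge0 ?degenerate_wt_ge0.
rewrite {1}/resonant_wt; case: ifP => [/and3P[/eqP E u0 v0]|_]; last first.
  by rewrite !addr_ge0.
have [z2|nz2] := eqVneq (p2.1 * p2.2) 0; last first.
  apply: (@le_trans _ _ (nondegenerate_wt b n0 n1 n2 ka (p0, p1, p2))); last lra.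
  rewrite /nondegenerate_wt /= (_ : ka - _ - _ = p2.1 * p2.2); last by rewrite -E; ring.
  rewrite nz2 eqxx; apply: int3_weight_prod_le => //; rewrite /th /eta; lra.
have [z1|nz1] := eqVneq (p1.1 * p1.2) 0; last first.
  apply: (@le_trans _ _ (nondegenerate_wt b n0 n2 n1 ka (p0, p2, p1))); last lra.
  rewrite /nondegenerate_wt /= (_ : ka - _ - _ = p1.1 * p1.2); last by rewrite -E; ring.
  rewrite nz1 eqxx [leRHS]mulrAC; apply: int3_weight_prod_le => //; rewrite /th /eta; lra.
have [z0|nz0] := eqVneq (p0.1 * p0.2) 0; last first.
  apply: (@le_trans _ _ (nondegenerate_wt b n1 n2 n0 ka (p1, p2, p0))); last lra.
  rewrite /nondegenerate_wt /= (_ : ka - _ - _ = p0.1 * p0.2); last by rewrite -E; ring.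
  rewrite nz0 eqxx [leRHS]mulrC [leRHS]mulrA; apply: int3_weight_prod_le => //; rewrite /th /eta; lra.
apply: (@le_trans _ _ (degenerate_wt b n0 p0 * degenerate_wt b n1 p1 * degenerate_wt b n2 p2)); last lra.
(* T says that the coordinate is charged to the first frequency. *)
pose T (p : P) := p.2 == 0.
pose c (p : P) : R := if T p then th else 0.
pose c' (p : P) : R := if T p then 0 else th.
have c0 p : 0 <= c p by rewrite /c; case: ifP.
have c0' p : 0 <= c' p by rewrite /c'; case: ifP.
have dw n p : p.1 * p.2 = 0 ->
    int_weight (c p) (n + p.1) * int_weight (c' p) (second_freq b n p.1 p.2) <= degenerate_wt b n p.
  rewrite /c /c' /degenerate_wt /T => /eqP; rewrite mulf_eq0.
  have j0 s : int_weight 0 s = 1 by rewrite /int_weight oppr0 powRr0.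
  have [p20|p20] := eqVneq p.2 0; rewrite j0 ?mulr1 ?mul1r.
    by move=> _; rewrite lerDl; case: ifP => // _; exact: int_weight_ge0.
  by rewrite orbF => ->; rewrite add0r.
apply: le_trans (ler_pM _ _ (ler_pM _ _ (dw n0 p0 z0) (dw n1 p1 z1)) (dw n2 p2 z2));
  rewrite ?mulr_ge0 ?int_weight_ge0//.
rewrite [leRHS](_ : _ = (int_weight (c p0) (n0 + p0.1) * int_weight (c p1) (n1 + p1.1) * int_weight (c p2) (n2 + p2.1)) *
  (int_weight (c' p0) (second_freq b n0 p0.1 p0.2) * int_weight (c' p1) (second_freq b n1 p1.1 p1.2) *
   int_weight (c' p2) (second_freq b n2 p2.1 p2.2))); last by ring.
have tT p : p.1 * p.2 = 0 -> ~~ T p -> p.1 = 0.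
  by rewrite /T => /eqP; rewrite mulf_eq0 => /orP[/eqP//|->].
have th2 : th + th <= al by rewrite /th; move: al1; lra.
rewrite ler_pM ?int3_weight_ge0//; apply: int3_weight_le => //; rewrite /c /c' /T.
  have : ~~ [&& T p0, T p1 & T p2].
    apply/negP => /and3P[]; rewrite /T => /eqP a0 /eqP a1 /eqP a2.
    by rewrite a0 a1 a2 !eqxx in v0.
  by rewrite /T; do 3 (case: ifP => _ //=); move=> _; move: th0 th2; lra.
have : [|| T p0, T p1 | T p2].
  apply: contraTT u0; rewrite !negb_or => /and3P[/(tT _ z0) -> /(tT _ z1) -> /(tT _ z2) ->].
  by rewrite !eqxx.
by rewrite /T; do 3 (case: ifP => _ //=); move=> _; move: th0 th2; lra.
Qed.

Lemma resonant_sum : exists2 C : R, 0 <= C &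
  forall b n0 n1 n2 ka, sums_le (resonant_wt b n0 n1 n2 ka) C.
Proof.
have [Cg hg] : exists C, sums_le (int_weight th) C by apply: int_weight_sum; rewrite /th; move: al1; lra.
have Cg0 := sums_le_ge0 hg.
have [C1 C10 h1] := one_coordinate_sum (eta := eta) ltac:(rewrite /eta; move: al1; lra).
have pw b n : sums_le (pair_wt th b n) (Cg * Cg).
  pose f (p : P) := int_weight th p.1 * int_weight th p.2.
  apply: (sums_le_injT (h := fun p : P => (n + p.1, second_freq b n p.1 p.2)) (f := f)).
    move=> [u v] [u' v'] [] /addrI -> /second_freq_inj -> //.
  by apply: (sums_le_prod (g := fun _ => int_weight th)) => // *; exact: int_weight_ge0.
have nd b n0 n1 n2 ka : sums_le (nondegenerate_wt b n0 n1 n2 ka) (Cg * Cg * (Cg * Cg) * C1).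
  pose f (p : P * P) := pair_wt th b n0 p.1 * pair_wt th b n1 p.2.
  pose g (p : P * P) (q : P) :=
   (if (ka - p.1.1 * p.1.2 - p.2.1 * p.2.2 != 0) &&
      (q.1 * q.2 == ka - p.1.1 * p.1.2 - p.2.1 * p.2.2)
   then pair_wt eta b n2 q else 0).
  apply: (sums_le_prod (f := f) (g := g)) => //.
  - by move=> p; rewrite mulr_ge0 ?pair_wt_ge0.
  - by move=> p q; rewrite /g; case: ifP => // _; exact: pair_wt_ge0.
  - apply: (sums_le_prod (g := fun _ => pair_wt th b n1)) => // *; try exact: pair_wt_ge0.
    exact: mulr_ge0.
  - move=> p; rewrite /g; have [->|nz] := eqVneq (ka - p.1.1 * p.1.2 - p.2.1 * p.2.2) 0.
      by move=> s _; rewrite big1.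
    exact: h1.
have dg b n : sums_le (degenerate_wt b n) (Cg + Cg).
  apply: sums_leD.
    apply: (sums_le_inj (P := fun p : P => p.2 == 0) (h := fun p : P => n + p.1) (f := int_weight th)) => //.
      exact: int_weight_ge0.
    by move=> [u v] [u' v'] /eqP /= -> /eqP /= -> /addrI ->.
  apply: (sums_le_inj (P := fun p : P => p.1 == 0) (h := fun p : P => second_freq b n p.1 p.2) (f := int_weight th)) => //.
    exact: int_weight_ge0.
  by move=> [u v] [u' v'] /eqP /= -> /eqP /= -> /second_freq_inj ->.
pose Cn := Cg * Cg * (Cg * Cg) * C1; pose Cd := (Cg + Cg) * (Cg + Cg) * (Cg + Cg).
exists (Cn + Cn + Cn + Cd) => [|b n0 n1 n2 ka].
  by rewrite !(addr_ge0, mulr_ge0).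
pose f1 := nondegenerate_wt b n0 n1 n2 ka.
pose f2 (p : (P * P) * P) := nondegenerate_wt b n0 n2 n1 ka (p.1.1, p.2, p.1.2).
pose f3 (p : (P * P) * P) := nondegenerate_wt b n1 n2 n0 ka (p.1.2, p.2, p.1.1).
pose f4 (p : (P * P) * P) := degenerate_wt b n0 p.1.1 * degenerate_wt b n1 p.1.2 * degenerate_wt b n2 p.2.
apply: (@sums_le_mono _ _ _ (fun p => f1 p + f2 p + f3 p + f4 p)).
  by move=> [[p0 p1] p2]; exact: resonant_split.
apply: sums_leD; [apply: sums_leD; [apply: sums_leD|]|].
- exact: nd.
- apply: (sums_le_injT (h := fun p : (P * P) * P => (p.1.1, p.2, p.1.2))) => //.
  by move=> [[? ?] ?] [[? ?] ?] /= [-> -> ->].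
- apply: (sums_le_injT (h := fun p : (P * P) * P => (p.1.2, p.2, p.1.1))) => //.
  by move=> [[? ?] ?] [[? ?] ?] /= [-> -> ->].
- apply: (sums_le_prod (f := fun p : P * P => degenerate_wt b n0 p.1 * degenerate_wt b n1 p.2)
     (g := fun _ => degenerate_wt b n2)) => // *; try (by rewrite ?mulr_ge0 ?degenerate_wt_ge0); first exact: addr_ge0.
  apply: (sums_le_prod (g := fun _ => degenerate_wt b n1)) => // *; try exact: degenerate_wt_ge0.
  exact: addr_ge0.
Qed.
End three_coordinates.

(** * Lattice sums over Z^3 *)

Section lattice_sums.
Variable R : realType.

Definition vec_weight (al : R) (n : Z3) : R := (1 + (sqnorm3 n)%:~R) `^ (- al).

Local Notation i0 := (0 : 'I_3).
Local Notation i1 := (1 : 'I_3).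
Local Notation i2 := (2 : 'I_3).

Lemma sqnorm3E (n : Z3) : sqnorm3 n = n 0 i0 ^+ 2 + n 0 i1 ^+ 2 + n 0 i2 ^+ 2.
Proof.
rewrite /sqnorm3 !big_ord_recr big_ord0 /= add0r.
by congr (_ + _ + _); congr (n _ _ ^+ 2); apply/val_inj.
Qed.

Lemma rV3P (m n : Z3) : m 0 i0 = n 0 i0 -> m 0 i1 = n 0 i1 -> m 0 i2 = n 0 i2 -> m = n.
Proof.
move=> h0 h1 h2; apply/rowP => -[[|[|[|//]]] h].
- by have -> : Ordinal h = i0 by apply/val_inj.
- by have -> : Ordinal h = i1 by apply/val_inj.
- by have -> : Ordinal h = i2 by apply/val_inj.
Qed.

Lemma vec_weightE al n : vec_weight al n = int3_weight al (n 0 i0) (n 0 i1) (n 0 i2).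
Proof. by rewrite /vec_weight /int3_weight sqnorm3E !rmorphD !rmorphXn /= !addrA. Qed.

Lemma vec_weight_ge0 al n : 0 <= vec_weight al n. Proof. exact: powR_ge0. Qed.

Lemma vec_weight_base_ge1 (n : Z3) : 1 <= 1 + (sqnorm3 n)%:~R :> R.
Proof. by rewrite lerDl ler0z sqnorm3E !addr_ge0 ?sqr_ge0. Qed.

Lemma vec_weight_base_gt0 (n : Z3) : 0 < 1 + (sqnorm3 n)%:~R :> R.
Proof. exact: lt_le_trans ltr01 (vec_weight_base_ge1 n). Qed.

Lemma vec_weight_gt0 al n : 0 < vec_weight al n.
Proof. by rewrite powR_gt0 ?vec_weight_base_gt0. Qed.

Lemma vec_weightX al be k n : be = al * k%:R -> vec_weight be n = vec_weight al n ^+ k.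
Proof. by move=> ->; rewrite /vec_weight -powR_mulrn ?powR_ge0// -powRrM mulNr. Qed.

Lemma vec_weight_sum be : 3 / 2 < be -> exists C, sums_le (vec_weight be) C.
Proof.
move=> be2; pose th := be / 3.
have th2 : 2^-1 < th by rewrite /th; lra.
have [C hC] := int_weight_sum th2; have C0 := sums_le_ge0 hC.
pose f (x : (int * int) * int) := int_weight th x.1.1 * int_weight th x.1.2 * int_weight th x.2.
exists (C * C * C).
apply: (@sums_le_mono _ _ _ (fun n : Z3 => f (n 0 i0, n 0 i1, n 0 i2))).
  by move=> n; rewrite vec_weightE; apply: int3_weight_le; rewrite /th; lra.
apply: (sums_le_injT (h := fun n : Z3 => (n 0 i0, n 0 i1, n 0 i2)) (f := f)).
  by move=> m n [] ? ? ?; exact: rV3P.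
apply: (sums_le_prod (f := fun x : int * int => int_weight th x.1 * int_weight th x.2) (g := fun _ => int_weight th)) => // *;
  rewrite ?mulr_ge0 ?int_weight_ge0//.
by apply: (sums_le_prod (g := fun _ => int_weight th)) => // *; exact: int_weight_ge0.
Qed.

(** For three nonnegative numbers, a^2 b^2 c^2 <= x^3 y^3 where x and y are
    the two largest. Each product on the right involves two independent
    frequencies and has the exponent 3 alpha / 2 > 3 / 2 needed in Z^3. *)
Lemma vec_weight_triple_le (al : R) (n p q : Z3) :
  vec_weight al (n + (q - p)) * vec_weight al p * vec_weight al q <=
  vec_weight (3 / 2 * al) (n + (q - p)) * vec_weight (3 / 2 * al) p +
  vec_weight (3 / 2 * al) p * vec_weight (3 / 2 * al) q +
  vec_weight (3 / 2 * al) (n + (q - p)) * vec_weight (3 / 2 * al) q.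
Proof.
have e2 m : vec_weight al m = vec_weight (al / 2) m ^+ 2 by apply: vec_weightX; field.
have e3 m : vec_weight (3 / 2 * al) m = vec_weight (al / 2) m ^+ 3 by apply: vec_weightX; field.
rewrite !e2 !e3.
have := vec_weight_ge0 (al / 2) (n + (q - p)); have := vec_weight_ge0 (al / 2) p; have := vec_weight_ge0 (al / 2) q.
move: (vec_weight (al / 2) q) (vec_weight (al / 2) p) (vec_weight (al / 2) (n + (q - p))) => c b a.
have key (x y z : R) : 0 <= x -> 0 <= y -> 0 <= z -> z <= x -> z <= y ->
    x ^+ 2 * y ^+ 2 * z ^+ 2 <= x ^+ 3 * y ^+ 3.
  move=> x0 y0 z0 zx zy.
  rewrite (_ : x ^+ 3 * y ^+ 3 = x ^+ 2 * y ^+ 2 * (x * y)); last by ring.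
  by rewrite ler_wpM2l ?mulr_ge0 ?sqr_ge0// expr2 ler_pM.
move=> c0 b0 a0.
have h1 : 0 <= a ^+ 3 * b ^+ 3 by rewrite mulr_ge0 ?exprn_ge0.
have h2 : 0 <= b ^+ 3 * c ^+ 3 by rewrite mulr_ge0 ?exprn_ge0.
have h3 : 0 <= a ^+ 3 * c ^+ 3 by rewrite mulr_ge0 ?exprn_ge0.
have k1 := key a b c a0 b0 c0; have k2 := key b c a b0 c0 a0; have k3 := key a c b a0 c0 b0.
have [ab|/ltW ba] := leP a b; have [bc|/ltW cb] := leP b c; have [ac|/ltW ca] := leP a c.
- by have := k2 ab ac; lra.
- by have := k2 ab (le_trans ab bc); lra.
- by have := k2 ab ac; lra.
- by have := k1 ca cb; lra.
- by have := k3 ba bc; lra.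
- by have := k3 ba bc; lra.
- by have := k1 (le_trans cb ba) cb; lra.
- by have := k1 ca cb; lra.
Qed.

Lemma shift_inj (n : Z3) (p q q' : Z3) : n + (q - p) = n + (q' - p) -> q = q'.
Proof. by move=> /addrI /addIr. Qed.

Lemma vec_weight_pair_sum be (C : R) (h : Z3 * Z3 -> Z3 * Z3) : injective h -> sums_le (vec_weight be) C ->
  sums_le (fun x => vec_weight be (h x).1 * vec_weight be (h x).2) (C * C).
Proof.
move=> hi hC; have C0 := sums_le_ge0 hC.
apply: (sums_le_injT (f := fun x : Z3 * Z3 => vec_weight be x.1 * vec_weight be x.2)) => //.
by apply: (sums_le_prod (g := fun _ => vec_weight be)) => // *; exact: vec_weight_ge0.
Qed.

(** Without the resonance condition the sum still converges, though not with
    the numerator <n>^(2 alpha) uniformly in n: this gives the absolute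
    convergence of the collision series. *)
Lemma unconstrained_sum (al : R) : 1 < al -> exists C, forall n,
  sums_le (fun x : Z3 * Z3 => vec_weight al (n + (x.2 - x.1)) * vec_weight al x.1 * vec_weight al x.2) C.
Proof.
move=> al1; have [|C hC] := @vec_weight_sum (3 / 2 * al); first lra.
exists (C * C + C * C + C * C) => n.
apply: sums_le_mono (fun x => vec_weight_triple_le al n x.1 x.2) _.
apply: sums_leD; [apply: sums_leD|].
- apply: (vec_weight_pair_sum (h := fun x => (n + (x.2 - x.1), x.1))) => //.
  by move=> [p q] [p' q'] /= [+ E]; rewrite E => /shift_inj ->.
- exact: (vec_weight_pair_sum (h := id)).
- apply: (vec_weight_pair_sum (h := fun x => (n + (x.2 - x.1), x.2))) => //.
  by move=> [p q] [p' q'] /= [+ E]; rewrite E => /addrI /addrI /oppr_inj ->.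
Qed.

(** The coordinate pairs (u_i, v_i) are grouped together because the resonance
    splits into the products u_i v_i. *)
Definition coords (u v : Z3) : ((int * int) * (int * int)) * (int * int) :=
  (((u 0 i0, v 0 i0), (u 0 i1, v 0 i1)), (u 0 i2, v 0 i2)).

Lemma coords_inj u v u' v' : coords u v = coords u' v' -> u = u' /\ v = v'.
Proof. by case=> *; split; exact: rV3P. Qed.

Definition dot_int3 (u v : Z3) : int := u 0 i0 * v 0 i0 + u 0 i1 * v 0 i1 + u 0 i2 * v 0 i2.

Lemma rV3_neq0 (u : Z3) : u != 0 -> [|| u 0 i0 != 0, u 0 i1 != 0 | u 0 i2 != 0].
Proof.
apply: contraR; rewrite !negb_or !negbK => /and3P[/eqP h0 /eqP h1 /eqP h2].
by apply/eqP/rV3P; rewrite mxE.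
Qed.

Lemma resonant_wt_coords (al : R) b (n u v : Z3) ka : dot_int3 u v = ka ->
  u != 0 -> v != 0 ->
  resonant_wt al b (n 0 i0) (n 0 i1) (n 0 i2) ka (coords u v) =
  vec_weight al (n + u) * vec_weight al (if b then n + u + v else n + v).
Proof.
move=> E /rV3_neq0 u0 /rV3_neq0 v0.
rewrite /resonant_wt /coords /= -E /dot_int3 eqxx u0 v0 !vec_weightE.
by case: b; rewrite /second_freq /= !mxE.
Qed.

Lemma vec_weightV (al : R) n : (vec_weight al n)^-1 = (1 + (sqnorm3 n)%:~R) `^ al.
Proof. by rewrite /vec_weight powRN invrK. Qed.

(** |n|^2 <= 3 (|a|^2 + |b|^2 + |c|^2), so 1 + |n|^2 is at most nine times the
    largest of the three corresponding quantities. *)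
Lemma numerator_le (al : R) (a b c n : Z3) : 0 <= al -> n = a + b - c ->
  (vec_weight al n)^-1 <= 9 `^ al * ((vec_weight al a)^-1 + (vec_weight al b)^-1 + (vec_weight al c)^-1).
Proof.
move=> al0 nE.
have sq (m : Z3) : 0 <= sqnorm3 m by rewrite sqnorm3E !addr_ge0 ?sqr_ge0.
have h : sqnorm3 n <= 3 * (sqnorm3 a + sqnorm3 b + sqnorm3 c).
  rewrite nE !sqnorm3E !mxE.
  have k (x y z : int) : (x + y - z) ^+ 2 <= 3 * (x ^+ 2 + y ^+ 2 + z ^+ 2).
    have := sqr_ge0 (x - y); have := sqr_ge0 (x + z); have := sqr_ge0 (y + z); lra.
  apply: le_trans (lerD (lerD (k _ _ _) (k _ _ _)) (k _ _ _)) _.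
  by rewrite le_eqVlt; apply/orP; left; apply/eqP; ring.
have main (m : Z3) : sqnorm3 n + 1 <= 9 * (sqnorm3 m + 1) ->
    (vec_weight al n)^-1 <= 9 `^ al * (vec_weight al m)^-1.
  move=> hm; rewrite !vec_weightV -powRM ?(ltW (vec_weight_base_gt0 _))//.
  apply: ge0_ler_powR; rewrite ?nnegrE ?mulr_ge0 ?(ltW (vec_weight_base_gt0 _))//.
  by move: hm; rewrite -(ler_int R) intrM !intrD; lra.
have p0 m : 0 <= (vec_weight al m)^-1 by rewrite invr_ge0 vec_weight_ge0.
have [n9|] : sqnorm3 n + 1 <= 9 * (sqnorm3 a + 1) \/ sqnorm3 n + 1 <= 9 * (sqnorm3 b + 1) \/
    sqnorm3 n + 1 <= 9 * (sqnorm3 c + 1).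
  by have := sq a; have := sq b; have := sq c; lia.
  apply: le_trans (main _ n9) _; rewrite ler_wpM2l ?powR_ge0//.
  by have := p0 b; have := p0 c; lra.
case=> n9; apply: le_trans (main _ n9) _; rewrite ler_wpM2l ?powR_ge0//;
  by have := p0 a; have := p0 b; have := p0 c; lra.
Qed.

(** The arithmetic core of the estimate: x = (p, q), a = n + q - p, b = p,
    c = q. With u = q - p and v = p - n the condition reads
    2 u.v = |n|^2 - tau. *)
Theorem resonant_lattice_sum (al : R) : 1 < al -> exists2 A : R, 0 <= A &
  forall n tau, sums_le (fun x : Z3 * Z3 =>
    if sqnorm3 (n + (x.2 - x.1)) + sqnorm3 x.1 - sqnorm3 x.2 == tau
    then vec_weight al (n + (x.2 - x.1)) * vec_weight al x.1 * vec_weight al x.2 / vec_weight al n else 0) A.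
Proof.
move=> al1; have [C C0 hC] := resonant_sum al1.
have [|D hD] := @vec_weight_sum (2 * al); first lra.
have D0 := sums_le_ge0 hD.
exists (9 `^ al * (C + C + C) + (D + D)) => [|n tau].
  by rewrite addr_ge0 ?mulr_ge0 ?powR_ge0 ?addr_ge0.
(* If |n|^2 - tau is odd there is no term; otherwise ka is the value of u.v. *)
pose ka := ((sqnorm3 n - tau) %/ 2)%Z.
pose res b := resonant_wt al b (n 0 i0) (n 0 i1) (n 0 i2) ka.
have res0 b x : 0 <= res b x.
  rewrite /res /resonant_wt; case: x => [[? ?] ?].
  by case: ifP => // _; rewrite mulr_ge0 ?int3_weight_ge0.
pose t1 (x : Z3 * Z3) := res false (coords (x.2 - x.1) (x.1 - n)).
pose t2 (x : Z3 * Z3) := res true (coords (x.2 - x.1) (x.1 - n)).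
pose t3 (x : Z3 * Z3) := res true (coords (x.1 - n) (x.2 - x.1)).
(* e1 and e2 are the cases u = 0 and v = 0. *)
pose e1 (x : Z3 * Z3) := if x.2 == x.1 then vec_weight (2 * al) x.1 else 0.
pose e2 (x : Z3 * Z3) := if x.1 == n then vec_weight (2 * al) x.2 else 0.
apply: (@sums_le_mono _ _ _ (fun x => 9 `^ al * (t1 x + t2 x + t3 x) + (e1 x + e2 x))); last first.
  apply: sums_leD; [apply: sums_leZ; [exact: powR_ge0|apply: sums_leD; [apply: sums_leD|]]|apply: sums_leD].
  - apply: (sums_le_injT (h := fun x : Z3 * Z3 => coords (x.2 - x.1) (x.1 - n)) (f := res false)); last exact: hC.
    by move=> [p q] [p' q'] /coords_inj /= [+ /addIr pp]; rewrite pp => /addIr ->.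
  - apply: (sums_le_injT (h := fun x : Z3 * Z3 => coords (x.2 - x.1) (x.1 - n)) (f := res true)); last exact: hC.
    by move=> [p q] [p' q'] /coords_inj /= [+ /addIr pp]; rewrite pp => /addIr ->.
  - apply: (sums_le_injT (h := fun x : Z3 * Z3 => coords (x.1 - n) (x.2 - x.1)) (f := res true)); last exact: hC.
    by move=> [p q] [p' q'] /coords_inj /= [/addIr pp]; rewrite pp => /addIr ->.
  - apply: (sums_le_inj (P := fun x : Z3 * Z3 => x.2 == x.1) (h := fst) (f := vec_weight (2 * al))) => //.
      exact: vec_weight_ge0.
    by move=> [p q] [p' q'] /eqP /= -> /eqP /= -> ->.
  - apply: (sums_le_inj (P := fun x : Z3 * Z3 => x.1 == n) (h := snd) (f := vec_weight (2 * al))) => //.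
      exact: vec_weight_ge0.
    by move=> [p q] [p' q'] /eqP /= -> /eqP /= -> ->.
move=> [p q]; pose u := q - p; pose v := p - n.
rewrite -[t1 _]/(res false (coords u v)) -[t2 _]/(res true (coords u v)).
rewrite -[t3 _]/(res true (coords v u)) /e1 /e2 -[(p, q).1]/p -[(p, q).2]/q.
have E0 : 0 <= 9 `^ al * (res false (coords u v) + res true (coords u v) + res true (coords v u)).
  by rewrite mulr_ge0 ?powR_ge0// !addr_ge0.
have w2 m : vec_weight (2 * al) m = vec_weight al m * vec_weight al m.
  by rewrite -expr2; apply: vec_weightX; rewrite mulrC.
have W0 m := vec_weight_gt0 al m.
have e10 : 0 <= (if q == p then vec_weight (2 * al) p else 0) by case: ifP => // _; exact: vec_weight_ge0.
have e20 : 0 <= (if p == n then vec_weight (2 * al) q else 0) by case: ifP => // _; exact: vec_weight_ge0.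
case: ifP => [/eqP tE|_]; last by rewrite !addr_ge0.
have [qp|qp] := eqVneq q p.
  apply: (@le_trans _ _ (vec_weight (2 * al) p)); last by move: E0 e20 ; lra.
  rewrite qp subrr addr0 w2 le_eqVlt; apply/orP; left; apply/eqP.
  by field; rewrite gt_eqF.
have [pn|pn] := eqVneq p n.
  apply: (@le_trans _ _ (vec_weight (2 * al) q)); last by move: E0 ; lra.
  rewrite pn addrC subrK w2 le_eqVlt; apply/orP; left; apply/eqP.
  by field; rewrite gt_eqF.
rewrite !addr0.
have dE : dot_int3 u v = ka.
  rewrite /ka (_ : sqnorm3 n - tau = dot_int3 u v * 2) ?mulzK//.
  by rewrite -tE !sqnorm3E /dot_int3 /u /v !mxE; ring.
have dE' : dot_int3 v u = ka by rewrite -dE /dot_int3; ring.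
have u0 : u != 0 by rewrite subr_eq0.
have v0 : v != 0 by rewrite subr_eq0.
have rE b x y : dot_int3 x y = ka -> x != 0 -> y != 0 -> res b (coords x y) =
    vec_weight al (n + x) * vec_weight al (if b then n + x + y else n + y).
  exact: resonant_wt_coords.
rewrite !rE//.
have -> : n + v = p by rewrite /v addrC subrK.
have -> : n + u + v = q by rewrite /u /v; apply/rowP => i; rewrite !mxE; ring.
have -> : p + u = q by rewrite /u addrC subrK.
have := numerator_le (a := n + u) (b := p) (c := q) (n := n) (ltW (lt_trans ltr01 al1)).
have nE : n = n + u + p - q by rewrite /u; apply/rowP => i; rewrite !mxE; ring.
move=> /(_ nE).
have := W0 (n + u); have := W0 p; have := W0 q.
move: (vec_weight al q) (vec_weight al p) (vec_weight al (n + u)) => c b a c0 b0 a0 h.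
rewrite [leRHS](_ : _ = a * b * c * (9 `^ al * (a^-1 + b^-1 + c^-1))); last first.
  by field; rewrite !gt_eqF.
by rewrite ler_wpM2l// ltW// !mulr_gt0.
Qed.

End lattice_sums.

Local Open Scope classical_set_scope.
Local Open Scope complex_scope.

(** * Complex-valued integrable functions *)

Section complex_numbers.
Variable R : realType.
Implicit Types x y : R[i].

Lemma cReD x y : complex.Re (x + y) = complex.Re x + complex.Re y.
Proof. by case: x => a b; case: y. Qed.

Lemma cImD x y : complex.Im (x + y) = complex.Im x + complex.Im y.
Proof. by case: x => a b; case: y. Qed.

Lemma cReM x y : complex.Re (x * y) =
  complex.Re x * complex.Re y - complex.Im x * complex.Im y.
Proof. by case: x => a b; case: y. Qed.

Lemma cImM x y : complex.Im (x * y) =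
  complex.Re x * complex.Im y + complex.Im x * complex.Re y.
Proof. by case: x => a b; case: y. Qed.

Lemma cRe_conjc x : complex.Re (conjc x) = complex.Re x. Proof. by case: x. Qed.
Lemma cIm_conjc x : complex.Im (conjc x) = - complex.Im x. Proof. by case: x. Qed.

Lemma complexP x y : complex.Re x = complex.Re y ->
  complex.Im x = complex.Im y -> x = y.
Proof. by case: x => a b; case: y => c d /= -> ->. Qed.

Lemma cRe_sum I (r : seq I) (P : pred I) (F : I -> R[i]) :
  complex.Re (\sum_(i <- r | P i) F i) = \sum_(i <- r | P i) complex.Re (F i).
Proof. exact: (big_morph _ cReD). Qed.

Lemma cIm_sum I (r : seq I) (P : pred I) (F : I -> R[i]) :
  complex.Im (\sum_(i <- r | P i) F i) = \sum_(i <- r | P i) complex.Im (F i).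
Proof. exact: (big_morph _ cImD). Qed.

(** The squared modulus is used rather than the modulus because it is
    polynomial in the real and imaginary parts. *)
Definition sqabs x : R := complex.Re x ^+ 2 + complex.Im x ^+ 2.

Lemma sqabs_ge0 x : 0 <= sqabs x.
Proof. by rewrite addr_ge0 ?sqr_ge0. Qed.

Lemma normc_sqr x : Normc.normc x ^+ 2 = sqabs x.
Proof. by case: x => a b; rewrite /= sqr_sqrtr // addr_ge0 ?sqr_ge0. Qed.

Lemma normc_sqrt x : Normc.normc x = Num.sqrt (sqabs x).
Proof. by case: x. Qed.

Lemma normc_ge0 x : 0 <= Normc.normc x.
Proof. by rewrite normc_sqrt sqrtr_ge0. Qed.

Lemma ler_normcD x y : Normc.normc (x + y) <= Normc.normc x + Normc.normc y.
Proof. by rewrite -lecR rmorphD; exact: (ler_normD x y). Qed.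

Lemma ler_normc_sum I (r : seq I) (P : pred I) (F : I -> R[i]) :
  Normc.normc (\sum_(i <- r | P i) F i) <= \sum_(i <- r | P i) Normc.normc (F i).
Proof.
elim/big_rec2 : _ => [|i a b _ h]; first by rewrite Normc.normc0.
by rewrite (le_trans (ler_normcD _ _))// lerD2l.
Qed.

Lemma sqabsM x y : sqabs (x * y) = sqabs x * sqabs y.
Proof. by rewrite -!normc_sqr Normc.normcM exprMn. Qed.

Lemma sqabs_conjc x : sqabs (conjc x) = sqabs x.
Proof. by rewrite /sqabs cRe_conjc cIm_conjc sqrrN. Qed.

Lemma sqabs_Re x : sqabs x = complex.Re (x * conjc x).
Proof. by rewrite cReM cRe_conjc cIm_conjc /sqabs; ring. Qed.

Lemma normc_le_ReIm x : Normc.normc x <= `|complex.Re x| + `|complex.Im x|.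
Proof.
rewrite -(ler_pXn2r (n := 2)) ?nnegrE ?normc_ge0 ?addr_ge0// normc_sqr sqrrD.
by rewrite !real_normK ?num_real// /sqabs addrAC lerDl mulrn_wge0 ?mulr_ge0.
Qed.

Lemma conjcM x y : conjc (x * y) = conjc x * conjc y.
Proof. by apply: complexP; rewrite ?(cReM, cImM, cRe_conjc, cIm_conjc); ring. Qed.

Lemma conjc_sum I (r : seq I) (P : pred I) (F : I -> R[i]) :
  conjc (\sum_(i <- r | P i) F i) = \sum_(i <- r | P i) conjc (F i).
Proof.
by apply: complexP; rewrite ?(cRe_sum, cIm_sum, cRe_conjc, cIm_conjc) -?sumrN;
  apply: eq_bigr => i _; rewrite ?(cRe_conjc, cIm_conjc).
Qed.

Lemma normc_nneg (a : R) : 0 <= a -> Normc.normc a%:C = a.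
Proof. by move=> a0; rewrite /= expr0n addr0 sqrtr_sqr ger0_norm. Qed.

Lemma ler_norm_1D (a b : R) : a ^+ 2 <= b -> `|a| <= 1 + b.
Proof.
move=> /(lerD (lexx 1)); apply: le_trans.
have := sqr_ge0 (`|a| - 2^-1); rewrite -(real_normK (num_real a)); nra.
Qed.

Lemma ler_Re_normc x : `|complex.Re x| <= Normc.normc x.
Proof.
rewrite -(ler_pXn2r (n := 2)) ?nnegrE ?normc_ge0// normc_sqr real_normK ?num_real//.
by rewrite lerDl sqr_ge0.
Qed.

Lemma ler_Im_normc x : `|complex.Im x| <= Normc.normc x.
Proof.
rewrite -(ler_pXn2r (n := 2)) ?nnegrE ?normc_ge0// normc_sqr real_normK ?num_real//.
by rewrite lerDr sqr_ge0.
Qed.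

Lemma cisD (a b : R) : cis (a + b) = cis a * cis b.
Proof. by apply: complexP; rewrite ?cReM ?cImM /= ?cosD ?sinD//; ring. Qed.

Lemma cisN (a : R) : cis (- a) = conjc (cis a).
Proof. by rewrite /cis cosN sinN. Qed.

Lemma cis0 : cis 0 = 1 :> R[i].
Proof. by rewrite /cis cos0 sin0. Qed.

Lemma sqabs_cis (a : R) : sqabs (cis a) = 1.
Proof. exact: cos2Dsin2. Qed.

Lemma normc_cis (a : R) : Normc.normc (cis a) = 1.
Proof. by rewrite normc_sqrt sqabs_cis sqrtr1. Qed.

End complex_numbers.

Section complex_integral.
Context d (T : measurableType d) (R : realType).
Variable mu : {measure set T -> \bar R}.
Implicit Types f g : T -> R[i].

Definition cmeasurable f := measurable_fun setT (fun x => complex.Re (f x)) /\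
  measurable_fun setT (fun x => complex.Im (f x)).

Lemma cmeasurable_cst (c : R[i]) : cmeasurable (fun=> c).
Proof. by split; exact: measurable_cst. Qed.

Lemma cmeasurableM f g : cmeasurable f -> cmeasurable g ->
  cmeasurable (fun x => f x * g x).
Proof.
move=> [f1 f2] [g1 g2]; split.
  under eq_fun do rewrite cReM.
  by apply: measurable_funB; exact: measurable_funM.
under eq_fun do rewrite cImM.
by apply: measurable_funD; exact: measurable_funM.
Qed.

Lemma cmeasurable_conj f : cmeasurable f -> cmeasurable (fun x => conjc (f x)).
Proof.
move=> [f1 f2]; split.
  by under eq_fun do rewrite cRe_conjc.
by under eq_fun do rewrite cIm_conjc; exact: measurableT_comp.
Qed.

Lemma cmeasurable_sum I (r : seq I) (F : I -> T -> R[i]) :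
  (forall i, cmeasurable (F i)) -> cmeasurable (fun x => \sum_(i <- r) F i x).
Proof.
move=> mF; split.
  by under eq_fun do rewrite cRe_sum; apply: measurable_sum => i; exact: (mF i).1.
by under eq_fun do rewrite cIm_sum; apply: measurable_sum => i; exact: (mF i).2.
Qed.

Lemma measurable_sqabs f : cmeasurable f ->
  measurable_fun setT (fun x => sqabs (f x)).
Proof. by move=> [? ?]; apply: measurable_funD; exact: measurable_funX. Qed.

Lemma cmeasurable_cis (h : T -> R) : measurable_fun setT h ->
  cmeasurable (fun x => cis (h x)).
Proof.
move=> mh; split => /=.
  by apply: measurableT_comp => //; exact: continuous_measurable_fun (@continuous_cos R).
by apply: measurableT_comp => //; exact: continuous_measurable_fun (@continuous_sin R).
Qed.

Lemma cintegrable_cmeasurable f : cintegrable mu f -> cmeasurable f.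
Proof. by move=> [/measurable_int/measurable_EFinP ? /measurable_int/measurable_EFinP]. Qed.

Lemma integrableZlr (c : R) (h : T -> R) : mu.-integrable setT (EFin \o h) ->
  mu.-integrable setT (fun x => (c * h x)%:E).
Proof. by move=> ih; under eq_fun do rewrite EFinM; exact: integrableZl. Qed.

Lemma cintegrableZ (c : R[i]) f : cintegrable mu f ->
  cintegrable mu (fun x => c * f x).
Proof.
move=> [f1 f2]; split.
  under eq_fun do rewrite cReM EFinB.
  by apply: integrableB => //; exact: integrableZlr.
under eq_fun do rewrite cImM EFinD.
by apply: integrableD => //; exact: integrableZlr.
Qed.

Lemma cintegrable_sum I (r : seq I) (F : I -> T -> R[i]) :
  (forall i, cintegrable mu (F i)) ->
  cintegrable mu (fun x => \sum_(i <- r) F i x).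
Proof.
move=> mF; split.
  under eq_fun do rewrite cRe_sum -sumEFin.
  by apply: integrable_sum => // i _; exact: (mF i).1.
under eq_fun do rewrite cIm_sum -sumEFin.
by apply: integrable_sum => // i _; exact: (mF i).2.
Qed.

Lemma Re_cintegral f :
  complex.Re (cintegral mu f) = \int[mu]_x complex.Re (f x).
Proof. by []. Qed.

Lemma Im_cintegral f :
  complex.Im (cintegral mu f) = \int[mu]_x complex.Im (f x).
Proof. by []. Qed.

Lemma cintegralD f g : cintegrable mu f -> cintegrable mu g ->
  cintegral mu (fun x => f x + g x) = cintegral mu f + cintegral mu g.
Proof.
move=> [f1 f2] [g1 g2]; apply: complexP; rewrite ?cReD ?cImD /=.
  by under eq_Rintegral do rewrite cReD; rewrite RintegralD.
by under eq_Rintegral do rewrite cImD; rewrite RintegralD.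
Qed.

Lemma cintegralZl (c : R[i]) f : cintegrable mu f ->
  cintegral mu (fun x => c * f x) = c * cintegral mu f.
Proof.
move=> [f1 f2]; apply: complexP; rewrite ?cReM ?cImM /=.
  under eq_Rintegral do rewrite cReM.
  by rewrite RintegralB ?RintegralZl//; exact: integrableZlr.
under eq_Rintegral do rewrite cImM.
by rewrite RintegralD ?RintegralZl//; exact: integrableZlr.
Qed.

Lemma cintegral0 : cintegral mu (fun=> 0) = 0.
Proof. by apply: complexP => /=; rewrite Rintegral_cst// mul0r. Qed.

Lemma cintegral_sum I (r : seq I) (F : I -> T -> R[i]) :
  (forall i, cintegrable mu (F i)) ->
  cintegral mu (fun x => \sum_(i <- r) F i x) =
  \sum_(i <- r) cintegral mu (F i).
Proof.
move=> iF; elim: r => [|i r IH].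
  by rewrite big_nil; under eq_fun do rewrite big_nil; exact: cintegral0.
rewrite big_cons -IH; under eq_fun do rewrite big_cons.
by rewrite cintegralD//; exact: cintegrable_sum.
Qed.

Lemma eq_cintegral f g : f =1 g -> cintegral mu f = cintegral mu g.
Proof. by move=> /funext ->. Qed.

End complex_integral.

Section complex_integral_finite.
Context d (T : measurableType d) (R : realType).
Variable mu : {finite_measure set T -> \bar R}.
Implicit Types f g : T -> R[i].

Lemma integrable_bounded (h : T -> R) (M : R) : measurable_fun setT h ->
  (forall x, `|h x| <= M) -> mu.-integrable setT (EFin \o h).
Proof.
move=> mh hM; apply: (@le_integrable _ _ _ mu setT measurableT _ (EFin \o cst M)).
- exact/measurable_EFinP.
- by move=> x _ /=; rewrite lee_fin (le_trans (hM x))// ler_norm.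
- exact: finite_measure_integrable_cst.
Qed.

Lemma cintegrable_bounded f (M : R) : cmeasurable f ->
  (forall x, Normc.normc (f x) <= M) -> cintegrable mu f.
Proof.
move=> [f1 f2] fM; split.
  by apply: (@integrable_bounded _ M) => // x; rewrite (le_trans (ler_Re_normc _)).
by apply: (@integrable_bounded _ M) => // x; rewrite (le_trans (ler_Im_normc _)).
Qed.

(** |x| <= 1 + x^2, and constants are integrable for a finite measure. *)
Lemma cintegrable_sqabs f : cmeasurable f ->
  mu.-integrable setT (fun x => (sqabs (f x))%:E) -> cintegrable mu f.
Proof.
move=> [f1 f2] if2.
have i1 : mu.-integrable setT (fun x => (1 + sqabs (f x))%:E).
  under eq_fun do rewrite EFinD.
  by apply: integrableD => //; exact: (finite_measure_integrable_cst mu 1).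
split; apply: (@le_integrable _ _ _ mu setT measurableT _ _ _ _ i1); try exact/measurable_EFinP.
  move=> x _; rewrite /= lee_fin [leRHS]ger0_norm; last exact: addr_ge0 ler01 (sqabs_ge0 _).
  by apply: ler_norm_1D; rewrite lerDl; exact: sqr_ge0.
move=> x _; rewrite /= lee_fin [leRHS]ger0_norm; last exact: addr_ge0 ler01 (sqabs_ge0 _).
by apply: ler_norm_1D; rewrite lerDr; exact: sqr_ge0.
Qed.

End complex_integral_finite.

(** * Integrals over product and tuple measures *)

Section product_integral.
Context d1 d2 (T1 : measurableType d1) (T2 : measurableType d2) (R : realType).
Variables (mu : {finite_measure set T1 -> \bar R})
          (nu : {finite_measure set T2 -> \bar R}).

Lemma Rintegral_prod (u : T1 -> R) (v : T2 -> R) (M N : R) :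
  measurable_fun setT u -> measurable_fun setT v ->
  (forall x, `|u x| <= M) -> (forall x, `|v x| <= N) ->
  \int[finite_product mu nu]_z (u z.1 * v z.2) =
  (\int[mu]_x u x) * (\int[nu]_y v y).
Proof.
move=> mu_ mv uM vN.
have iu : mu.-integrable setT (EFin \o u) by exact: integrable_bounded uM.
have iv : nu.-integrable setT (EFin \o v) by exact: integrable_bounded vN.
have iuv : (finite_product mu nu).-integrable setT
    (EFin \o (fun z : T1 * T2 => u z.1 * v z.2)).
  apply: (@integrable_bounded _ _ _ (finite_product mu nu) _ (M * N)).
    by apply: measurable_funM; exact: measurableT_comp.
  by move=> z; rewrite normrM ler_pM.
rewrite /Rintegral -(integral12_prod_meas1 iuv)/=.
transitivity (fine (\int[mu]_x ((u x)%:E * \int[nu]_y (v y)%:E))%E).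
  congr fine; apply: eq_integral => x _; rewrite /fubini_F/=.
  by under eq_integral do rewrite EFinM; rewrite integralZl.
have fv : (\int[nu]_y (v y)%:E)%E \is a fin_num by exact: integrable_fin_num.
rewrite -(fineK fv) integralZr// fineM//.
exact: integrable_fin_num.
Qed.

Lemma cintegral_prod (f : T1 -> R[i]) (g : T2 -> R[i]) (M N : R) :
  cmeasurable f -> cmeasurable g ->
  (forall x, Normc.normc (f x) <= M) -> (forall x, Normc.normc (g x) <= N) ->
  cintegral (finite_product mu nu) (fun z => f z.1 * g z.2) =
  cintegral mu f * cintegral nu g.
Proof.
move=> [mf1 mf2] [mg1 mg2] fM gN.
have f1 x : `|complex.Re (f x)| <= M by exact: le_trans (ler_Re_normc _) _.
have f2 x : `|complex.Im (f x)| <= M by exact: le_trans (ler_Im_normc _) _.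
have g1 x : `|complex.Re (g x)| <= N by exact: le_trans (ler_Re_normc _) _.
have g2 x : `|complex.Im (g x)| <= N by exact: le_trans (ler_Im_normc _) _.
have I (u : T1 -> R) (v : T2 -> R) : measurable_fun setT u ->
    measurable_fun setT v -> (forall x, `|u x| <= M) ->
    (forall x, `|v x| <= N) ->
    (finite_product mu nu).-integrable setT
      (EFin \o (fun z : T1 * T2 => u z.1 * v z.2)).
  move=> *; apply: (@integrable_bounded _ _ _ (finite_product mu nu) _ (M * N)).
    by apply: measurable_funM; exact: measurableT_comp.
  by move=> z; rewrite normrM ler_pM.
apply: complexP; rewrite ?cReM ?cImM !(Re_cintegral, Im_cintegral).
  under eq_Rintegral do rewrite cReM.
  rewrite (RintegralB measurableT (I _ _ mf1 mg1 f1 g1) (I _ _ mf2 mg2 f2 g2)).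
  rewrite (Rintegral_prod mf1 mg1 f1 g1).
  by rewrite (Rintegral_prod mf2 mg2 f2 g2).
under eq_Rintegral do rewrite cImM.
rewrite (RintegralD measurableT (I _ _ mf1 mg2 f1 g2) (I _ _ mf2 mg1 f2 g1)).
rewrite (Rintegral_prod mf1 mg2 f1 g2).
by rewrite (Rintegral_prod mf2 mg1 f2 g1).
Qed.

End product_integral.

Section tuple_integral.
Context d (T : measurableType d) (R : realType).
Variable mu : {finite_measure set T -> \bar R}.

Lemma cintegral_tuple_cons n (nu : {finite_measure set (n.-tuple T) -> \bar R})
    (h : n.+1.-tuple T -> R[i]) (M : R) : cmeasurable h ->
  (forall x, Normc.normc (h x) <= M) ->
  cintegral (tuple_cons_measure mu nu) h =
  cintegral (finite_product mu nu) (h \o @tuple_cons _ T n).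
Proof.
move=> [mh1 mh2] hM.
have mt := @measurable_tuple_cons _ T n.
have E (u : n.+1.-tuple T -> R) : measurable_fun setT u ->
    (forall x, `|u x| <= M) ->
    \int[tuple_cons_measure mu nu]_x u x =
    \int[finite_product mu nu]_z u (tuple_cons z).
  move=> mu_ uM; rewrite /Rintegral /tuple_cons_measure.
  rewrite (integral_pushforward mt)//.
    exact/measurable_EFinP.
  rewrite preimage_setT.
  apply: (@integrable_bounded _ _ _ (finite_product mu nu) (u \o @tuple_cons _ T n) M).
    exact: measurableT_comp.
  by move=> z; exact: uM.
apply: complexP => /=; apply: E => // x; apply: le_trans (hM x).
  exact: ler_Re_normc.
exact: ler_Im_normc.
Qed.

Lemma cmeasurable_comp d' (T' : measurableType d') (g : T' -> T)
    (f : T -> R[i]) : measurable_fun setT g -> cmeasurable f ->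
  cmeasurable (f \o g).
Proof.
move=> mg [f1 f2]; split.
  exact: (measurableT_comp f1 mg).
exact: (measurableT_comp f2 mg).
Qed.

Lemma cmeasurable_prod I (r : seq I) d' (T' : measurableType d')
    (F : I -> T' -> R[i]) :
  (forall i, cmeasurable (F i)) -> cmeasurable (fun x => \prod_(i <- r) F i x).
Proof.
move=> mF; elim: r => [|i r IH].
  by under eq_fun do rewrite big_nil; exact: cmeasurable_cst.
by under eq_fun do rewrite big_cons; exact: cmeasurableM.
Qed.

Lemma ler_normc_prod1 I (r : seq I) (F : I -> R[i]) :
  (forall i, Normc.normc (F i) <= 1) -> Normc.normc (\prod_(i <- r) F i) <= 1.
Proof.
move=> F1; elim/big_rec : _ => [|i x _ h]; first by rewrite Normc.normc1.
by rewrite Normc.normcM mulr_ile1 ?normc_ge0.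
Qed.

(** Iterated Fubini along the recursive construction of the tuple measure. *)
Lemma cintegral_tuple n (f : 'I_n -> T -> R[i]) :
  (forall i, cmeasurable (f i)) ->
  (forall i x, Normc.normc (f i x) <= 1) ->
  cintegral (tuple_measure mu n) (fun x => \prod_(i < n) f i (tnth x i)) =
  \prod_(i < n) cintegral mu (f i).
Proof.
elim: n f => [|n IH] f mf f1.
  rewrite big_ord0; under eq_cintegral do rewrite big_ord0.
  apply: complexP; rewrite (Re_cintegral, Im_cintegral) /= Rintegral_cst//.
    by rewrite [X in fine X](_ : _ = 1%E) ?mulr1//; exact: diracT.
  by rewrite mul0r.
have mprod m (g : 'I_m -> T -> R[i]) : (forall i, cmeasurable (g i)) ->
    cmeasurable (fun x : m.-tuple T => \prod_(i < m) g i (tnth x i)).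
  move=> mg; apply: cmeasurable_prod => i.
  exact: (cmeasurable_comp (measurable_tnth i) (mg i)).
rewrite (@cintegral_tuple_cons _ (tuple_measure mu n) _ 1); last 2 first.
- exact: (mprod _ f).
- by move=> x; exact: ler_normc_prod1.
rewrite big_ord_recl -(IH (fun i => f (lift ord0 i)))//.
rewrite -(@cintegral_prod _ _ _ _ _ _ _ _ _ 1 1)//.
- apply: eq_cintegral => -[x t]; rewrite /= big_ord_recl /=; congr (_ * _).
  by apply: eq_bigr => i _; rewrite (tnth_nth x)/= (tnth_nth x).
- exact: (mprod _ (fun i => f (lift ord0 i))).
- by move=> x; exact: ler_normc_prod1.
Qed.

End tuple_integral.

(** * Orthogonality of the characters *)

Section period_integral.
Variable R : realType.

Lemma Rintegral_period (f : R -> R) :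
  (period_measure R).-integrable setT (EFin \o f) ->
  \int[period_measure R]_t f t =
  \int[lebesgue_measure]_(t in `[0, 2 * pi]) f t.
Proof.
move=> if_.
pose D : set (measurableTypeR R) := `[0, 2 * pi]%classic.
have mD : measurable D by exact: measurable_itv.
rewrite /Rintegral; congr fine.
rewrite (negligible_integral (measurableC mD) measurableT if_); last first.
  by rewrite /= /period_measure /mrestr -/D setICl measure0.
rewrite setTD setCK; apply: eq_measure_integral => A mA AD.
by rewrite -[in RHS](setIidl AD).
Qed.

Lemma sin_2piM (m : nat) : sin (m%:R * (2 * pi)) = 0 :> R.
Proof.
have -> : m%:R * (2 * pi) = 0 + pi *+ 2 *+ m :> R by rewrite add0r !mulr_natl.
by rewrite (periodicn (@sinD2pi R)) sin0.
Qed.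

Lemma cos_2piM (m : nat) : cos (m%:R * (2 * pi)) = 1 :> R.
Proof.
have -> : m%:R * (2 * pi) = 0 + pi *+ 2 *+ m :> R by rewrite add0r !mulr_natl.
by rewrite (periodicn (@cosD2pi R)) cos0.
Qed.

Lemma cis_2piM (m : int) : cis (m%:~R * (2 * pi)) = 1 :> R[i].
Proof.
have H (n : nat) : cis (n%:R * (2 * pi)) = 1 :> R[i].
  by rewrite /cis sin_2piM cos_2piM.
case: m => n; first exact: H.
by rewrite NegzE mulrNz mulNr cisN H; apply: complexP => /=; rewrite ?oppr0.
Qed.

(** Fundamental theorem of calculus on one period. *)
Lemma Rintegral_period_derive (f F : R -> R) (M : R) :
  (forall t : R, is_derive t 1 F (f t)) -> continuous f ->
  (forall t, `|f t| <= M) ->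
  \int[period_measure R]_t f t = F (2 * pi) - F 0.
Proof.
move=> dF cf fM.
rewrite Rintegral_period; last first.
  apply: (@integrable_bounded _ _ _ (period_measure R) _ M) => //.
  exact: continuous_measurable_fun.
have pi0 : 0 < 2 * pi :> R by rewrite mulr_gt0// pi_gt0.
have cF : continuous F.
  by move=> x; apply/differentiable_continuous/derivable1_diffP; case: (dF x).
rewrite /Rintegral (continuous_FTC2 (F := F) pi0)//.
- exact: continuous_subspaceT.
- split.
  + by move=> x _; case: (dF x).
  + exact/cvg_at_right_filter/cF.
  + exact/cvg_at_left_filter/cF.
- by move=> x _; rewrite derive1E; case: (dF x).
Qed.

Lemma cintegral_period_cis (m : int) :
  cintegral (period_measure R) (fun t => cis (m%:~R * t)) =
  (if m == 0 then 2 * pi else 0)%:C.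
Proof.
have bc (t : R) : `|cos t| <= 1 by rewrite ler_norml cos_geN1 cos_le1.
have bs (t : R) : `|sin t| <= 1 by rewrite ler_norml sin_geN1 sin_le1.
case: eqVneq => [->|m0].
  apply: complexP; rewrite (Re_cintegral, Im_cintegral) /=.
    have dF (t : R) : is_derive t 1 id (cos (0 * t)).
      by rewrite mul0r cos0; exact: is_derive_id.
    rewrite (Rintegral_period_derive dF _ (fun t => bc _)) ?subr0// => t.
    by under eq_fun do rewrite mul0r cos0; exact: cst_continuous.
  by under eq_Rintegral do rewrite mul0r sin0; rewrite Rintegral_cst// mul0r.
set a : R := m%:~R; have a0 : a != 0 by rewrite intr_eq0.
have ca : continuous ( *%R a) by move=> t; exact: mulrl_continuous.
have [c1 s0] : cos (a * (2 * pi)) = 1 /\ sin (a * (2 * pi)) = 0.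
  by have [-> ->] := cis_2piM m.
apply: complexP; rewrite (Re_cintegral, Im_cintegral) /=.
  have dF (t : R) : is_derive t 1 (fun t => a^-1 * sin (a * t)) (cos (a * t)).
    by apply: is_derive_eq; rewrite /GRing.scale/=; field.
  rewrite (Rintegral_period_derive dF _ (fun t => bc _)).
    by rewrite s0 !mulr0 sin0 mulr0 subr0.
  by move=> t; apply: continuous_comp; [exact: ca|exact: continuous_cos].
have dF (t : R) : is_derive t 1 (fun t => - a^-1 * cos (a * t)) (sin (a * t)).
  by apply: is_derive_eq; rewrite /GRing.scale/=; field.
rewrite (Rintegral_period_derive dF _ (fun t => bs _)).
  by rewrite c1 !mulr0 cos0 mulr1 subrr.
by move=> t; apply: continuous_comp; [exact: ca|exact: continuous_sin].
Qed.
End period_integral.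

Section characters.
Variable R : realType.

Lemma cis_sum I (r : seq I) (F : I -> R) :
  cis (\sum_(i <- r) F i) = \prod_(i <- r) cis (F i).
Proof. exact: (big_morph _ (@cisD R) (cis0 R)). Qed.

(** A product of Kronecker symbols is the Kronecker symbol of the tuple. *)
Lemma prod_eq0_if n (P : pred 'I_n) (c : R) :
  \prod_(i < n) (if P i then c else 0)%:C =
  (if [forall i, P i] then c ^+ n else 0)%:C.
Proof.
case: ifPn => [/forallP Pi|/forallPn[i nPi]].
  under eq_bigr do rewrite Pi.
  by rewrite prodr_const card_ord rmorphXn.
by rewrite (bigD1 i)//= (negbTE nPi) mul0r.
Qed.

Lemma cmeasurable_char3 (n : 'rV[int]_3) :
  cmeasurable (fun x : torus R => cis (dot3 x n)).
Proof.
apply: cmeasurable_cis; apply: measurable_sum => i.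
by apply: measurable_funM => //; exact: measurable_tnth.
Qed.

Lemma cintegral_char3 (n : 'rV[int]_3) :
  cintegral (torus_measure R) (fun x => cis (dot3 x n)) =
  (if n == 0 then (2 * pi) ^+ 3 else 0)%:C.
Proof.
under eq_cintegral do rewrite /dot3 cis_sum.
have := @cintegral_tuple _ _ _ (period_measure R) 3
  (fun i t => cis (t * (n 0 i)%:~R)) => ->; first last.
- by move=> i x; rewrite normc_cis.
- by move=> i; apply: cmeasurable_cis; exact: measurable_funM.
under eq_bigr => i _.
  under eq_cintegral do rewrite mulrC.
  rewrite cintegral_period_cis.
  over.
rewrite prod_eq0_if; congr (if _ then _ else _)%:C.
apply/forallP/eqP => [n0|-> i]; last by rewrite mxE.
by apply/rowP => i; rewrite mxE; exact/eqP.
Qed.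

Lemma dot3B (x : torus R) (m n : 'rV[int]_3) : dot3 x (m - n) = dot3 x m - dot3 x n.
Proof.
by rewrite /dot3 -sumrB; apply: eq_bigr => i _; rewrite !mxE intrB mulrBr.
Qed.

Lemma measurable_dot k (n : freq k) :
  measurable_fun setT (fun x : config R k => dot x n).
Proof.
apply: measurable_sum => j; apply: measurable_sum => i.
apply: measurable_funM => //.
exact: (measurableT_comp (measurable_tnth i) (measurable_tnth j)).
Qed.

Lemma cintegral_char k (m n : freq k) :
  cintegral (config_measure R k) (fun x => cis (dot x m - dot x n)) =
  (if m == n then (2 * pi) ^+ 3 ^+ k else 0)%:C.
Proof.
under eq_cintegral => x.
  rewrite /dot -sumrB cis_sum.
  under eq_bigr do rewrite -dot3B.
  over.
have := @cintegral_tuple _ _ _ (torus_measure R) k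
  (fun j x => cis (dot3 x (tnth m j - tnth n j))) => ->; first last.
- by move=> i x; rewrite normc_cis.
- by move=> i; exact: cmeasurable_char3.
under eq_bigr do rewrite cintegral_char3.
rewrite prod_eq0_if; congr (if _ then _ else _)%:C.
apply/forallP/eqP => [n0|-> i]; last by rewrite subrr.
by apply: eq_from_tnth => i; apply/eqP; rewrite -subr_eq0.
Qed.

Definition character k (y : freq k * freq k) (z : config R k * config R k) :
  R[i] := cis (dot z.1 y.1 - dot z.2 y.2).

Definition volume k : R := (2 * pi) ^+ 3 ^+ k * (2 * pi) ^+ 3 ^+ k.

Lemma cmeasurable_character k (y : freq k * freq k) : cmeasurable (character y).
Proof.
apply: cmeasurable_cis; apply: measurable_funB.
  exact: (measurableT_comp (measurable_dot y.1) measurable_fst).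
exact: (measurableT_comp (measurable_dot y.2) measurable_snd).
Qed.

Lemma cintegral_character k (y y' : freq k * freq k) :
  cintegral (kernel_measure R k) (fun z => character y z * conjc (character y' z)) =
  (if y == y' then volume k else 0)%:C.
Proof.
under eq_cintegral => z.
  rewrite /character -cisN -cisD.
  rewrite (_ : _ + _ = (dot z.1 y.1 - dot z.1 y'.1) + (dot z.2 y'.2 - dot z.2 y.2)); last by ring.
  rewrite cisD.
  over.
have mc m n : cmeasurable (fun x : config R k => cis (dot x m - dot x n)).
  by apply: cmeasurable_cis; apply: measurable_funB; exact: measurable_dot.
rewrite (@cintegral_prod _ _ _ _ _ _ _
  (fun x => cis (dot x y.1 - dot x y'.1)) (fun x => cis (dot x y'.2 - dot x y.2)) 1 1)//;
  try by move=> x; rewrite normc_cis.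
rewrite !cintegral_char -rmorphM; congr _%:C.
case: y y' => [y1 y2] [y1' y2']; rewrite xpair_eqE /=.
rewrite (eq_sym y2'); case: (y1 == y1'); case: (y2 == y2'); by rewrite ?mulr0 ?mul0r.
Qed.
End characters.

(** * The L2 norm and orthogonal systems *)

Section L2.
Context d (T : measurableType d) (R : realType).
Variable mu : {measure set T -> \bar R}.
Implicit Types f : T -> R[i].

Definition energy f : \bar R := (\int[mu]_x (sqabs (f x))%:E)%E.

Lemma energy_ge0 f : (0 <= energy f)%E.
Proof. by apply: integral_ge0 => x _; rewrite lee_fin sqabs_ge0. Qed.

Lemma L2normE f : L2norm mu f = (energy f `^ 2^-1)%E.
Proof.
rewrite /L2norm /energy unlock /Lnorm; congr (_ `^ _)%E.
apply: eq_integral => x _ /=.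
by rewrite ger0_norm ?normc_ge0// powR_mulrn ?normc_ge0// normc_sqr.
Qed.

(** The energy, an integral, is easier to estimate than its square root. *)
Lemma memL2P f : memL2 mu f <-> cmeasurable f /\ (energy f < +oo)%E.
Proof.
rewrite /memL2 L2normE; split=> [[? ? h]|[[? ?] h]].
  by split=> //; apply: lty_poweRy h; rewrite invr_eq0.
by split=> //; exact: poweR_lty.
Qed.

Lemma memL2_integrable f : memL2 mu f ->
  mu.-integrable setT (fun x => (sqabs (f x))%:E).
Proof.
move=> /memL2P[mf h]; apply/integrableP; split.
  by apply/measurable_EFinP; exact: measurable_sqabs.
by under eq_integral do rewrite gee0_abs ?lee_fin ?sqabs_ge0//.
Qed.
End L2.

Lemma L2norm_le d d' (T : measurableType d) (T' : measurableType d')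
    (R : realType) (mu : {measure set T -> \bar R})
    (mu' : {measure set T' -> \bar R}) (f : T -> R[i]) (g : T' -> R[i])
    (C : R) : 0 <= C -> (energy mu f <= (C ^+ 2)%:E * energy mu' g)%E ->
  (L2norm mu f <= C%:E * L2norm mu' g)%E.
Proof.
move=> C0 h; rewrite !L2normE.
apply: (@le_trans _ _ (((C ^+ 2)%:E * energy mu' g) `^ 2^-1)%E).
  apply: gt0_ler_poweR; rewrite ?invr_ge0// in_itv/= ?andbT ?leey ?andbT.
  - exact: energy_ge0.
  - by rewrite mule_ge0 ?energy_ge0// lee_fin sqr_ge0.
rewrite poweRM ?energy_ge0 ?lee_fin ?sqr_ge0// poweR_EFin.
by rewrite powR12_sqrt ?sqr_ge0// sqrtr_sqr ger0_norm.
Qed.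

Section orthogonal_system.
Context d (T : measurableType d) (R : realType).
Variable mu : {finite_measure set T -> \bar R}.
Variables (Y : eqType) (e : Y -> T -> R[i]) (V : R).

(** Modulus one everywhere, not just norm V: boundedness makes every product
    with a basis function integrable. *)
Definition orthogonal_system := [/\ 0 < V, forall y, cmeasurable (e y),
  forall y x, sqabs (e y x) = 1 &
  forall y y', cintegral mu (fun x => e y x * conjc (e y' x)) =
               (if y == y' then V else 0)%:C].

Hypothesis oe : orthogonal_system.

Lemma orthogonal_normc y x : Normc.normc (e y x) = 1.
Proof. by case: oe => _ _ h _; rewrite normc_sqrt h sqrtr1. Qed.

Lemma orthogonal_measurable y : cmeasurable (e y).
Proof. by case: oe. Qed.

Lemma cintegrable_ee y y' : cintegrable mu (fun x => e y x * conjc (e y' x)).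
Proof.
apply: (@cintegrable_bounded _ _ _ mu _ 1).
  apply: cmeasurableM; last apply: cmeasurable_conj; exact: orthogonal_measurable.
by move=> x; rewrite normc_sqrt sqabsM sqabs_conjc -!normc_sqr !orthogonal_normc !expr1n mulr1 sqrtr1.
Qed.

Lemma cintegrable_mul_conj f y : cintegrable mu f ->
  cintegrable mu (fun x => f x * conjc (e y x)).
Proof.
move=> if_.
have m : cmeasurable (fun x => f x * conjc (e y x)).
  apply: cmeasurableM; first exact: cintegrable_cmeasurable if_.
  exact/cmeasurable_conj/orthogonal_measurable.
have n x : Normc.normc (f x * conjc (e y x)) = Normc.normc (f x).
  rewrite Normc.normcM [X in _ * X]normc_sqrt sqabs_conjc -normc_sqrt.
  by rewrite orthogonal_normc mulr1.
have i1 : mu.-integrable setT (fun x => (`|complex.Re (f x)| + `|complex.Im (f x)|)%:E).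
  under eq_fun do rewrite EFinD.
  by apply: integrableD => //; apply: integrable_norm; case: if_.
case: m => m1 m2; split;
  apply: (@le_integrable _ _ _ mu setT measurableT _ _ _ _ i1);
  try exact/measurable_EFinP; move=> x _; rewrite lee_fin [leRHS]ger0_norm ?addr_ge0//;
  apply: le_trans (normc_le_ReIm _); rewrite -n; [exact: ler_Re_normc|exact: ler_Im_normc].
Qed.

Section trig_sum.
Variables (I : Type) (s : seq I) (y : I -> Y) (b : I -> R[i]).

Definition trig_sum x := \sum_(i <- s) b i * e (y i) x.

Lemma cmeasurable_trig : cmeasurable trig_sum.
Proof.
apply: cmeasurable_sum => i; apply: cmeasurableM; first exact: cmeasurable_cst.
exact: orthogonal_measurable.
Qed.

Lemma normc_trig x : Normc.normc (trig_sum x) <= \sum_(i <- s) Normc.normc (b i).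
Proof.
apply: le_trans (ler_normc_sum _ _ _) _; apply: ler_sum => i _.
by rewrite Normc.normcM orthogonal_normc mulr1.
Qed.

(** Indices may share the same basis function: the coefficient collects them. *)
Lemma trig_coef y0 : cintegral mu (fun x => trig_sum x * conjc (e y0 x)) =
  V%:C * \sum_(i <- s | y i == y0) b i.
Proof.
transitivity (cintegral mu (fun x => \sum_(i <- s) b i * (e (y i) x * conjc (e y0 x)))).
  by apply: eq_cintegral => x; rewrite /trig_sum mulr_suml; under eq_bigr do rewrite -mulrA.
rewrite cintegral_sum; last first.
  by move=> i; exact/cintegrableZ/cintegrable_ee.
rewrite mulr_sumr [RHS]big_mkcond; apply: eq_bigr => i _ /=.
rewrite cintegralZl; last exact: cintegrable_ee.
by case: oe => _ _ _ ->; case: ifP; rewrite ?mulr0// mulrC.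
Qed.

Lemma trig_norm : \int[mu]_x sqabs (trig_sum x) =
  V * \sum_(j <- s) \sum_(i <- s | y i == y j) complex.Re (b i * conjc (b j)).
Proof.
transitivity (complex.Re (cintegral mu
    (fun x => \sum_(j <- s) conjc (b j) * (trig_sum x * conjc (e (y j) x))))).
  rewrite Re_cintegral; apply: eq_Rintegral => x _; rewrite sqabs_Re; congr complex.Re.
  rewrite {2}/trig_sum conjc_sum mulr_sumr; apply: eq_bigr => j _.
  by rewrite conjcM; ring.
have it y0 : cintegrable mu (fun x => trig_sum x * conjc (e y0 x)).
  apply: cintegrable_mul_conj; apply: (@cintegrable_bounded _ _ _ mu).
    exact: cmeasurable_trig.
  exact: normc_trig.
rewrite cintegral_sum; last by move=> j; exact: cintegrableZ.
rewrite cRe_sum mulr_sumr; apply: eq_bigr => j _.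
rewrite cintegralZl// trig_coef mulrCA cReM/= mul0r subr0.
rewrite mulr_sumr cRe_sum; congr (_ * _); apply: eq_bigr => i _.
by rewrite mulrC.
Qed.
End trig_sum.

(** Nonnegativity of the energy of f minus its orthogonal projection on the
    functions e_y, y in s. *)
Lemma bessel f : memL2 mu f ->
  sums_le (fun y => sqabs (cintegral mu (fun x => f x * conjc (e y x))))
       (V * \int[mu]_x sqabs (f x)).
Proof.
move=> f2 s us.
have [mf _] := (memL2P mu f).1 f2.
have if2 := memL2_integrable f2.
have if_ := cintegrable_sqabs mf if2.
set c := fun y => cintegral mu (fun x => f x * conjc (e y x)).
have V0 : 0 < V by case: oe.
pose b y := (V^-1)%:C * c y.
pose g := trig_sum s id b.
have mg : cmeasurable g by exact: cmeasurable_trig.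
have ig : mu.-integrable setT (fun x => (sqabs (g x))%:E).
  apply: (@integrable_bounded _ _ _ mu _ ((\sum_(i <- s) Normc.normc (b i)) ^+ 2)).
    exact: measurable_sqabs.
  move=> x; rewrite ger0_norm ?sqabs_ge0// -normc_sqr.
  by rewrite ler_pXn2r ?nnegrE ?normc_ge0 ?sumr_ge0 ?normc_trig// => i _; exact: normc_ge0.
have fgE x : f x * conjc (g x) = \sum_(y <- s) conjc (b y) * (f x * conjc (e y x)).
  rewrite /g /trig_sum conjc_sum mulr_sumr; apply: eq_bigr => y _.
  by rewrite conjcM; ring.
have ife y : cintegrable mu (fun x => f x * conjc (e y x)) by exact: cintegrable_mul_conj.
have ifg : cintegrable mu (fun x => f x * conjc (g x)).
  under eq_fun do rewrite fgE.
  by apply: cintegrable_sum => y; exact: cintegrableZ.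
have bc y : complex.Re (conjc (b y) * c y) = V^-1 * sqabs (c y).
  rewrite sqabs_Re /b conjcM !cReM !(cReM, cImM, cRe_conjc, cIm_conjc) /=; ring.
have Ifg : \int[mu]_x complex.Re (f x * conjc (g x)) = V^-1 * \sum_(y <- s) sqabs (c y).
  rewrite -Re_cintegral (eq_cintegral _ fgE) cintegral_sum; last first.
    by move=> y; exact: cintegrableZ.
  rewrite cRe_sum mulr_sumr; apply: eq_bigr => y _.
  by rewrite cintegralZl// bc.
have Ig : \int[mu]_x sqabs (g x) = V^-1 * \sum_(y <- s) sqabs (c y).
  rewrite /g trig_norm !mulr_sumr; rewrite big_seq [RHS]big_seq; apply: eq_bigr => y ys.
  rewrite big_mkcond (bigD1_seq y ys us) eqxx big1 ?addr0; last by move=> i /negbTE ->.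
  by rewrite -sqabs_Re /b sqabsM /sqabs /=; field; rewrite gt_eqF.
have : 0 <= \int[mu]_x sqabs (f x - g x) by apply: Rintegral_ge0 => x _; exact: sqabs_ge0.
have -> : \int[mu]_x sqabs (f x - g x) =
    \int[mu]_x (sqabs (f x) - 2 * complex.Re (f x * conjc (g x)) + sqabs (g x)).
  apply: eq_Rintegral => x _.
  by rewrite /sqabs cReM cRe_conjc cIm_conjc; case: (f x) => ? ?; case: (g x) => ? ? /=; ring.
have i2 : mu.-integrable setT (fun x => (2 * complex.Re (f x * conjc (g x)))%:E).
  by apply: integrableZlr; case: ifg.
have i12 : mu.-integrable setT
    (fun x => (sqabs (f x) - 2 * complex.Re (f x * conjc (g x)))%:E).
  by under eq_fun do rewrite EFinB; exact: integrableB.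
rewrite (RintegralD measurableT i12 ig) (RintegralB measurableT if2 i2).
rewrite (RintegralZl _ measurableT); last by case: ifg.
rewrite Ifg Ig => h.
rewrite -(ler_pM2l (x := V^-1)) ?invr_gt0// mulKf ?gt_eqF//.
by move: h; rewrite -/c; lra.
Qed.

End orthogonal_system.

(** * Schur's test *)

Section schur.
Context d (T : measurableType d) (R : realType).
Variable mu : {finite_measure set T -> \bar R}.
Variables (Y : eqType) (e : Y -> T -> R[i]) (V : R).
Hypothesis oe : orthogonal_system mu e V.

(** The energy is V times the sum of Re (b_i conj b_j) over pairs sharing a basis
    function, with b_i = r_i c_i, and
      |b_i| |b_j| <= (r_i^2 |c_j|^2 + r_j^2 |c_i|^2) / 2.
    Summing first over the index carried by r produces A. *)
Lemma trig_schur (I : eqType) (y : I -> Y) (r : I -> R) (c : I -> R[i])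
    (A : R) (s : seq I) : uniq s -> (forall i, 0 <= r i) ->
  (forall y0, sums_le (fun i => if y i == y0 then r i ^+ 2 else 0) A) ->
  \int[mu]_x sqabs (trig_sum e s y (fun i => (r i)%:C * c i) x) <=
  V * (A * \sum_(i <- s) sqabs (c i)).
Proof.
move=> us r0 rA; have [V0 _ _ _] := oe.
rewrite (trig_norm oe) ler_pM2l//.
pose n i := Normc.normc (c i).
have S1 : \sum_(j <- s) \sum_(i <- s | y i == y j) r i ^+ 2 * n j ^+ 2 <=
    A * \sum_(i <- s) sqabs (c i).
  rewrite mulr_sumr; apply: ler_sum => j _.
  rewrite -mulr_suml /n normc_sqr ler_wpM2r ?sqabs_ge0// big_mkcond.
  exact: rA.
have S2 : \sum_(j <- s) \sum_(i <- s | y i == y j) r j ^+ 2 * n i ^+ 2 <=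
    A * \sum_(i <- s) sqabs (c i).
  rewrite (exchange_big_dep xpredT)//=; apply: le_trans S1.
  by apply: ler_sum => j _; under eq_bigl do rewrite eq_sym.
apply: (@le_trans _ _ (\sum_(j <- s) \sum_(i <- s | y i == y j)
  (2^-1 * (r i ^+ 2 * n j ^+ 2) + 2^-1 * (r j ^+ 2 * n i ^+ 2)))).
  apply: ler_sum => j _; apply: ler_sum => i _.
  apply: le_trans (ler_norm _) _; apply: le_trans (ler_Re_normc _) _.
  rewrite Normc.normcM [X in _ * X]normc_sqrt sqabs_conjc -normc_sqrt.
  rewrite !Normc.normcM !normc_nneg// -/(n i) -/(n j).
  have := sqr_ge0 (r i * n j - r j * n i); nra.
apply: (@le_trans _ _ (2^-1 * \sum_(j <- s) \sum_(i <- s | y i == y j) r i ^+ 2 * n j ^+ 2 +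
  2^-1 * \sum_(j <- s) \sum_(i <- s | y i == y j) r j ^+ 2 * n i ^+ 2)); last by lra.
rewrite !mulr_sumr -big_split le_eqVlt; apply/orP; left; apply/eqP.
by apply: eq_bigr => j _; rewrite !mulr_sumr -big_split.
Qed.
End schur.

(** * Exhaustion of a countable index set *)

(** Convergence along the directed set of finite subsets: it is insensitive to
    the order of summation and to reindexing. *)
Definition has_csum (R : realType) (I : eqType) (u : I -> R[i]) (L : R[i]) :=
  forall eps : R, 0 < eps -> exists s0 : seq I, forall s, uniq s ->
    {subset s0 <= s} -> Normc.normc (\sum_(i <- s) u i - L) <= eps.

Section exhaustion.
Variables (R : realType) (I : countType) (f : I -> R) (B : R).
Hypothesis fB : sums_le f B.

Lemma sums_le_tail (eps : R) : 0 < eps -> exists s0 : seq I, uniq s0 /\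
  forall s, uniq s -> ~~ has (mem s0) s -> \sum_(i <- s) f i <= eps.
Proof.
move=> e0.
pose E := [set x : R | exists2 s : seq I, uniq s & x = \sum_(i <- s) f i].
have supE : has_sup E.
  split; first by exists 0, [::]; rewrite ?big_nil.
  by exists B => x [s us ->]; exact: fB.
have [x [s0 us0 ->] h] := sup_adherent e0 supE.
exists s0; split=> // s us s0s.
have : \sum_(i <- s0 ++ s) f i <= sup E.
  by apply: (ub_le_sup supE.2); exists (s0 ++ s) => //; rewrite cat_uniq us0 us andbT.
by rewrite big_cat/=; move: h; lra.
Qed.

(** Finite sets S_n that exhaust the index set, outside of which the tails of
    the series decay geometrically. S_0 is empty, so that the partial sums are
    sums of increments. *)
Lemma sums_le_exhaustion : 0 <= B -> exists S : nat -> seq I,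
  [/\ forall n, uniq (S n), forall n, {subset S n <= S n.+1},
      forall i, exists n, i \in S n &
      forall n s, uniq s -> ~~ has (mem (S n)) s ->
        \sum_(i <- s) f i <= (B + 1) * 4^-1 ^+ n] /\ S 0 = [::].
Proof.
move=> B0.
have e0 n : 0 < (B + 1) * 4^-1 ^+ n :> R by rewrite mulr_gt0 ?exprn_gt0//; lra.
pose t n := sval (cid (sums_le_tail (e0 n))).
pose S := fix S n : seq I := if n is m.+1 then
  undup (S m ++ t m.+1 ++ (if unpickle m is Some i then [:: i] else [::])) else [::].
exists S; split=> //; split.
- by case=> [|n] //=; exact: undup_uniq.
- by move=> n i iS; rewrite /= mem_undup mem_cat iS.
- by move=> i; exists (pickle i).+1; rewrite /= mem_undup !mem_cat pickleK inE eqxx !orbT.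
- case=> [|n] s us.
    by move=> _; rewrite expr0 mulr1 (le_trans (fB us))// lerDl.
  rewrite -all_predC => /allP h.
  have [_] := svalP (cid (sums_le_tail (e0 n.+1))); apply => //.
  rewrite -all_predC; apply/allP => i /h /=; apply: contra => it.
  by rewrite mem_undup !mem_cat it orbT.
Qed.

End exhaustion.

Section nested.
Variables (I : eqType) (S : nat -> seq I).
Hypotheses (uS : forall n, uniq (S n)) (nS : forall n, {subset S n <= S n.+1}).

Definition increment n := [seq i <- S n.+1 | i \notin S n].

Lemma increment_uniq n : uniq (increment n).
Proof. exact: filter_uniq. Qed.

Lemma increment_disjoint n : ~~ has (mem (S n)) (increment n).
Proof.
by rewrite -all_predC; apply/allP => i; rewrite mem_filter => /andP[].
Qed.

Lemma nested_le m n : (m <= n)%N -> {subset S m <= S n}.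
Proof.
move=> /subnKC <-; elim: (n - m)%N => [|k IH] i; first by rewrite addn0.
by rewrite addnS => /IH /nS.
Qed.

Lemma sum_increment (V : nmodType) (u : I -> V) n :
  \sum_(i <- S n.+1) u i = \sum_(i <- S n) u i + \sum_(i <- increment n) u i.
Proof.
rewrite (bigID (mem (S n)))/= -[X in X + _]big_filter -[X in _ + X]big_filter.
congr (_ + _).
apply: perm_big; apply: uniq_perm => //; first exact: filter_uniq.
by move=> i; rewrite mem_filter; apply: andb_idr => /nS.
Qed.
End nested.

Section limits.
Variable R : realType.

Lemma limn_einf_le (u : (\bar R)^nat) (c : \bar R) :
  (forall n, u n <= c)%E -> (limn_einf u <= c)%E.
Proof.
move=> uc; rewrite limn_einf_lim; apply: lime_le; first exact: is_cvg_einfs.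
apply: nearW => n; apply: le_trans (uc n); apply: ereal_inf_lbound.
by exists n => //=.
Qed.

Lemma nneseries_fin_bound (u : nat -> R) : (forall n, 0 <= u n) ->
  (\sum_(n <oo) (u n)%:E < +oo)%E -> cvgn (series u).
Proof.
move=> u0 fin; apply: nondecreasing_is_cvgn; first exact: nondecreasing_series.
have fn : (\sum_(n <oo) (u n)%:E)%E \is a fin_num.
  by rewrite ge0_fin_numE// nneseries_ge0// => n _ _; rewrite lee_fin.
exists (fine (\sum_(n <oo) (u n)%:E)%E) => _ [n _ <-].
rewrite -lee_fin fineK// /series/= -sumEFin.
by apply: nneseries_lim_ge => k _ _; rewrite lee_fin.
Qed.
End limits.

(** * Riesz-Fischer *)

Section orthogonal_product.
Context d1 d2 (T1 : measurableType d1) (T2 : measurableType d2) (R : realType).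
Variables (mu1 : {finite_measure set T1 -> \bar R})
          (mu2 : {finite_measure set T2 -> \bar R}).
Variables (Y1 Y2 : eqType) (e1 : Y1 -> T1 -> R[i]) (e2 : Y2 -> T2 -> R[i]).
Variables (V1 V2 : R).
Hypotheses (oe1 : orthogonal_system mu1 e1 V1) (oe2 : orthogonal_system mu2 e2 V2).

Definition tensor (y : Y1 * Y2) (x : T1 * T2) := e1 y.1 x.1 * e2 y.2 x.2.

Lemma orthogonal_tensor :
  orthogonal_system (finite_product mu1 mu2) tensor (V1 * V2).
Proof.
have [V10 m1 n1 o1] := oe1; have [V20 m2 n2 o2] := oe2.
split.
- exact: mulr_gt0.
- move=> y; apply: cmeasurableM.
    exact: (cmeasurable_comp measurable_fst (m1 y.1)).
  exact: (cmeasurable_comp measurable_snd (m2 y.2)).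
- by move=> y x; rewrite sqabsM n1 n2 mulr1.
- move=> [y1 y2] [y1' y2']; rewrite /tensor/=.
  transitivity (cintegral (finite_product mu1 mu2) (fun z =>
    (e1 y1 z.1 * conjc (e1 y1' z.1)) * (e2 y2 z.2 * conjc (e2 y2' z.2)))).
    by apply: eq_cintegral => z; rewrite conjcM; ring.
  have b1 x : Normc.normc (e1 y1 x * conjc (e1 y1' x)) <= 1.
    by rewrite normc_sqrt sqabsM sqabs_conjc !n1 mulr1 sqrtr1.
  have b2 x : Normc.normc (e2 y2 x * conjc (e2 y2' x)) <= 1.
    by rewrite normc_sqrt sqabsM sqabs_conjc !n2 mulr1 sqrtr1.
  rewrite (@cintegral_prod _ _ _ _ _ _ _ (fun x => e1 y1 x * conjc (e1 y1' x))
    (fun x => e2 y2 x * conjc (e2 y2' x)) 1 1)//; last 2 first.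
  - exact: cmeasurableM (m1 _) (cmeasurable_conj (m1 _)).
  - exact: cmeasurableM (m2 _) (cmeasurable_conj (m2 _)).
  rewrite o1 o2 xpair_eqE -rmorphM.
  by case: (y1 == y1'); case: (y2 == y2'); rewrite ?mulr0 ?mul0r.
Qed.
End orthogonal_product.

Definition part (R : realType) (b : bool) (x : R[i]) :=
  if b then complex.Re x else complex.Im x.

Section parts.
Variable R : realType.
Implicit Types x y : R[i].

Lemma part0 b : part b 0 = 0 :> R. Proof. by case: b. Qed.

Lemma partD b x y : part b (x + y) = part b x + part b y.
Proof. by case: b; rewrite /part ?cReD ?cImD. Qed.

Lemma ler_part b x : `|part b x| <= Normc.normc x.
Proof. by case: b; [exact: ler_Re_normc|exact: ler_Im_normc]. Qed.

(** Bounds a modulus by its square linearly, without a square root, the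
    parameter p being chosen to balance a geometric decay. *)
Lemma normc_amgm (p : R) x : 0 < p -> Normc.normc x <= 2^-1 * (p^-1 + p * sqabs x).
Proof.
move=> p0; rewrite -normc_sqr; set n := Normc.normc x.
have E : (n - p^-1) ^+ 2 * p = p * n ^+ 2 - 2 * n + p^-1 by field; rewrite gt_eqF.
have : 0 <= (n - p^-1) ^+ 2 * p by rewrite mulr_ge0 ?sqr_ge0// ltW.
rewrite E; lra.
Qed.
End parts.

Section riesz_fischer.
Context d (T : measurableType d) (R : realType).
Variable mu : {finite_measure set T -> \bar R}.
Variables (q : nat -> T -> R[i]) (K : R).
Hypotheses (mq : forall n, cmeasurable (q n)).
Hypothesis qK : forall n, (energy mu (q n) <= (K * 4^-1 ^+ n)%:E)%E.

Definition partial_sum n x := \sum_(i < n) q i x.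
Local Notation Q := partial_sum.

(** The weight 2^n is smaller than the decay rate 4^n of the energies, so that
    the dominant is integrable, yet large enough to control the sum of the
    moduli through [normc_amgm]. *)
Definition dominant x : \bar R := (\sum_(n <oo) (2 ^+ n * sqabs (q n x))%:E)%E.
Local Notation G := dominant.

Let g_ge0 n x : 0 <= 2 ^+ n * sqabs (q n x).
Proof. by rewrite mulr_ge0 ?exprn_ge0 ?sqabs_ge0. Qed.

Let mg n : measurable_fun setT (fun x => (2 ^+ n * sqabs (q n x))%:E).
Proof.
by apply/measurable_EFinP; apply: measurable_funM => //; exact: measurable_sqabs.
Qed.

Lemma dominant_ge0 x : (0 <= G x)%E.
Proof. by apply: nneseries_ge0 => n _ _; rewrite lee_fin. Qed.

Lemma measurable_dominant : measurable_fun setT G.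
Proof.
apply: ge0_emeasurable_sum; last by move=> *.
by move=> *; rewrite lee_fin.
Qed.

Lemma integrable_dominant : mu.-integrable setT G.
Proof.
apply/integrableP; split; first exact: measurable_dominant.
under eq_integral do rewrite gee0_abs ?dominant_ge0//.
rewrite /G integral_nneseries//; last by move=> n x _; rewrite lee_fin.
apply: (@le_lt_trans _ _ (\sum_(n <oo) ((2 * K) / (2 ^ (n + 1))%:R)%:E)%E).
  apply: lee_nneseries => [n _|n _].
    by move=> *; apply: integral_ge0 => x _; rewrite lee_fin.
  under eq_integral do rewrite EFinM.
  rewrite ge0_integralZl//; last 2 first.
  - by apply/measurable_EFinP; exact: measurable_sqabs.
  - by move=> x _; rewrite lee_fin sqabs_ge0.
  apply: (@le_trans _ _ ((2 ^+ n)%:E * (K * 4^-1 ^+ n)%:E)%E).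
    by rewrite lee_wpmul2l ?lee_fin ?exprn_ge0//; exact: qK.
  rewrite -EFinM lee_fin natrX exprD expr1 le_eqVlt; apply/orP; left; apply/eqP.
  have -> : 4 = 2 ^+ 2 :> R by ring.
  rewrite exprVn -exprM mulnC exprM; field.
  by rewrite expf_neq0.
by have /cvg_lim -> // := @cvg_geometric_eseries_half R (2 * K) 0; rewrite ltry.
Qed.

Let D : set T := [set x | (G x < +oo)%E].

Lemma part_cvg b x : (G x < +oo)%E -> cvgn (fun n => part b (Q n x)).
Proof.
move=> /(nneseries_fin_bound (g_ge0 ^~ x)) cG.
have -> : (fun n => part b (Q n x)) = series (fun n => part b (q n x)).
  apply/funext => n; rewrite /partial_sum /series/= big_mkord.
  by apply: (big_morph _ (@partD R b)); exact: part0.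
apply: normed_cvg; apply: (@series_le_cvg _ _
  (fun n => 2^-1 * (geometric 1 2^-1 n + 2 ^+ n * sqabs (q n x)))).
- by move=> n; exact: normr_ge0.
- by move=> n; rewrite mulr_ge0 ?invr_ge0// addr_ge0// /geometric/= mul1r exprn_ge0// invr_ge0.
- move=> n; apply: le_trans (ler_part _ _) _.
  rewrite /geometric/= mul1r exprVn; apply: normc_amgm; exact: exprn_gt0.
apply: is_cvg_seriesZ; rewrite (_ : series _ = series (geometric 1 2^-1) +
    series (fun n => 2 ^+ n * sqabs (q n x))); last first.
  by rewrite -seriesD.
apply: is_cvgD => //; apply: is_cvg_geometric_series.
by rewrite ger0_norm ?invr_ge0// invf_lt1// ltr1n.
Qed.

(** One integrable function dominates all the partial sums. *)
Lemma normc_partial_sum n x : ((Normc.normc (Q n x))%:E <= 1 + G x)%E.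
Proof.
apply: (@le_trans _ _ (\sum_(i < n) (2^-1 * (2^-1 ^+ i + 2 ^+ i * sqabs (q i x)))%:E)%E).
  rewrite sumEFin lee_fin; apply: le_trans (ler_normc_sum _ _ _) _.
  apply: ler_sum => i _; rewrite exprVn; apply: normc_amgm; exact: exprn_gt0.
apply: (@le_trans _ _ ((\sum_(i < n) (2^-1 * 2^-1 ^+ i))%:E +
   \sum_(i < n) (2 ^+ i * sqabs (q i x))%:E)%E).
  rewrite !sumEFin -EFinD lee_fin -big_split/=; apply: ler_sum => i _.
  by have := g_ge0 i x; set u := 2^-1 ^+ i; lra.
apply: leeD.
  rewrite lee_fin (_ : \sum_(i < n) _ = 1 - 2^-1 ^+ n) ?lerBlDr ?lerDl ?exprn_ge0 ?invr_ge0//.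
  elim: n => [|n IH]; first by rewrite big_ord0 expr0 subrr.
  by rewrite big_ord_recr/= IH exprS; set u := 2^-1 ^+ n; lra.
rewrite -(big_mkord xpredT (fun i => (2 ^+ i * sqabs (q i x))%:E)).
by apply: nneseries_lim_ge => k _ _; rewrite lee_fin.
Qed.

(** Set to 0 on the null set where the dominant is infinite; truncating the
    partial sums in the same way makes them converge everywhere, whence the
    measurability of the limit. *)
Definition limit_fun x : R[i] :=
  if `[< D x >] then limn (fun n => part true (Q n x)) +i* limn (fun n => part false (Q n x))
  else 0.
Local Notation F := limit_fun.

Definition trunc_sum n x := if `[< D x >] then Q n x else 0.
Local Notation Q' := trunc_sum.

Lemma trunc_sum_cvg b x : part b (Q' n x) @[n --> \oo] --> part b (F x).
Proof.
rewrite /trunc_sum /limit_fun; case: asboolP => Dx; last exact: cvg_cst.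
case: b.
  rewrite [X in _ --> X](_ : _ = limn (fun n => part true (Q n x)))//.
  exact: (@part_cvg true x Dx).
rewrite [X in _ --> X](_ : _ = limn (fun n => part false (Q n x)))//.
exact: (@part_cvg false x Dx).
Qed.

Let mD : measurable D.
Proof.
by have := emeasurable_fun_infty_o measurableT measurable_dominant +oo%E; rewrite setTI.
Qed.

Lemma cmeasurable_partial_sum n : cmeasurable (Q n).
Proof. exact: cmeasurable_sum. Qed.

Lemma cmeasurable_trunc_sum n : cmeasurable (Q' n).
Proof.
rewrite (_ : Q' n = fun x => (\1_D x)%:C * Q n x); last first.
  apply/funext => x; rewrite /trunc_sum indicE.
  by case: asboolP => Dx; rewrite ?(mem_set Dx) ?(memNset Dx) ?mul1r ?mul0r.
apply: cmeasurableM; last exact: cmeasurable_partial_sum.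
by split => /=; [exact: measurable_indic|exact: measurable_cst].
Qed.

Lemma cmeasurable_limit_fun : cmeasurable F.
Proof.
split.
  apply: (@measurable_fun_cvg _ _ _ _ (fun n x => part true (Q' n x))).
    by move=> n; exact: (cmeasurable_trunc_sum n).1.
  by move=> x _; exact: @trunc_sum_cvg true x.
apply: (@measurable_fun_cvg _ _ _ _ (fun n x => part false (Q' n x))).
  by move=> n; exact: (cmeasurable_trunc_sum n).2.
by move=> x _; exact: @trunc_sum_cvg false x.
Qed.

(** Fatou's lemma: no constant is lost in the limit. *)
Lemma energy_limit_fun (E : \bar R) : (forall n, energy mu (Q n) <= E)%E ->
  (energy mu F <= E)%E.
Proof.
move=> QE.
have H : energy mu F = (\int[mu]_x limn_einf (fun n => (sqabs (Q' n x))%:E))%E.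
  apply: eq_integral => x _; apply/esym.
  have cv : (sqabs (Q' n x))%:E @[n --> \oo] --> (sqabs (F x))%:E.
    apply: cvg_EFin; first exact: nearW.
    have h1 := @trunc_sum_cvg true x; have h2 := @trunc_sum_cvg false x.
    by apply: cvgD; apply: cvgM.
  by rewrite is_cvg_limn_einfE; [exact: cvg_lim|apply/cvg_ex; eexists; exact: cv].
rewrite H; apply: le_trans (fatou _ _ _ _) _ => //.
- move=> n; apply/measurable_EFinP; apply: measurable_sqabs.
  exact: cmeasurable_trunc_sum.
- by move=> n x _; rewrite lee_fin sqabs_ge0.
apply: limn_einf_le => n; apply: le_trans (QE n).
apply: ge0_le_integral => //.
- by move=> x _; rewrite lee_fin sqabs_ge0.
- apply/measurable_EFinP; apply: measurable_sqabs; exact: cmeasurable_trunc_sum.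
- apply/measurable_EFinP; apply: measurable_sqabs; exact: cmeasurable_partial_sum.
- move=> x _; rewrite lee_fin /trunc_sum; case: asboolP => // _.
  by rewrite /sqabs /= expr0n addr0 ?addr_ge0 ?sqr_ge0.
Qed.

End riesz_fischer.

(** * Time slices *)

Section slices.
Context d1 d2 (T1 : measurableType d1) (T2 : measurableType d2) (R : realType).
Variables (mu1 : {finite_measure set T1 -> \bar R})
          (mu2 : {finite_measure set T2 -> \bar R}).
Variables (q : nat -> T1 * T2 -> R[i]) (K : R).
Hypotheses (mq : forall n, cmeasurable (q n)).
Hypothesis qK : forall n,
  (energy (finite_product mu1 mu2) (q n) <= (K * 4^-1 ^+ n)%:E)%E.

(** By Fubini, the dominant remains integrable on almost every time slice, which
    is where dominated convergence is applied. *)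
Lemma ae_slice_dominant :
  {ae mu1, forall t, mu2.-integrable setT (fun z => dominant q (t, z))}.
Proof. exact: (ae_integrable1 (integrable_dominant mq qK)). Qed.

Lemma cmeasurable_slice (f : T1 * T2 -> R[i]) t : cmeasurable f ->
  cmeasurable (fun z => f (t, z)).
Proof.
move=> [f1 f2]; split.
  exact: (measurableT_comp f1 (pair1_measurable t)).
exact: (measurableT_comp f2 (pair1_measurable t)).
Qed.

Lemma measurable_part b d (T : measurableType d) (f : T -> R[i]) :
  cmeasurable f -> measurable_fun setT (fun x => part b (f x)).
Proof. by case=> ? ?; case: b. Qed.

Lemma part_mul_cvg b (u : nat -> R[i]) (l c : R[i]) :
  (forall b, part b (u n) @[n --> \oo] --> part b l) ->
  part b (u n * c) @[n --> \oo] --> part b (l * c).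
Proof.
move=> ul; have u1 := ul true; have u2 := ul false.
case: b; rewrite /part ?cReM ?cImM.
  under eq_fun do rewrite cReM.
  by apply: cvgB; apply: cvgMl.
under eq_fun do rewrite cImM.
by apply: cvgD; apply: cvgMl.
Qed.

Lemma slice_cvg b t (h : T2 -> R[i]) :
  mu2.-integrable setT (fun z => dominant q (t, z)) ->
  cmeasurable h -> (forall z, Normc.normc (h z) = 1) ->
  \int[mu2]_z part b (partial_sum q n (t, z) * h z) @[n --> \oo] -->
  \int[mu2]_z part b (limit_fun q (t, z) * h z).
Proof.
move=> iG mh h1.
have mf := cmeasurable_slice t (cmeasurable_limit_fun mq).
have mfn n := cmeasurable_slice t (cmeasurable_partial_sum mq n).
have [|||||i1 _ c1] := @dominated_convergence _ _ _ mu2 setT measurableT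
  (fun n z => (part b (partial_sum q n (t, z) * h z))%:E)
  (fun z => (part b (limit_fun q (t, z) * h z))%:E)
  (fun z => 1 + dominant q (t, z))%E.
- by move=> n; apply/measurable_EFinP; apply: measurable_part; exact: cmeasurableM.
- by apply/measurable_EFinP; apply: measurable_part; exact: cmeasurableM.
- have := integrable_ae measurableT iG; apply: filterS => z /(_ I) fz _.
  have Gz : (dominant q (t, z) < +oo)%E by rewrite -ge0_fin_numE// dominant_ge0.
  apply: cvg_EFin; first exact: nearW.
  apply: part_mul_cvg => b'.
  have := @trunc_sum_cvg _ _ _ q b' (t, z).
  by rewrite /trunc_sum asboolT.
- by apply: integrableD => //; exact: (finite_measure_integrable_cst mu2 1).
- apply: aeW => z n _; apply: le_trans (normc_partial_sum q n (t, z)).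
  by rewrite lee_fin; apply: le_trans (ler_part _ _) _; rewrite Normc.normcM h1 mulr1.
rewrite /Rintegral; apply: fine_cvg; rewrite fineK//.
exact: integrable_fin_num.
Qed.
End slices.

(** * Series of products of orthogonal functions *)

Lemma energy_trig d (T : measurableType d) (R : realType)
    (mu : {finite_measure set T -> \bar R}) (Y : eqType) (e : Y -> T -> R[i])
    (V : R) (I : Type) (s : seq I) (y : I -> Y) (b : I -> R[i]) :
  orthogonal_system mu e V ->
  energy mu (trig_sum e s y b) = (\int[mu]_x sqabs (trig_sum e s y b x))%:E.
Proof.
move=> oe; rewrite /energy /Rintegral fineK//.
apply: integrable_fin_num => //.
apply: (@integrable_bounded _ _ _ mu _ ((\sum_(i <- s) Normc.normc (b i)) ^+ 2)).
  by apply: measurable_sqabs; exact: (cmeasurable_trig oe).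
move=> x; rewrite ger0_norm ?sqabs_ge0// -normc_sqr.
rewrite ler_pXn2r ?nnegrE ?normc_ge0 ?sumr_ge0 ?(normc_trig oe)// => i _.
exact: normc_ge0.
Qed.

(** An unordered sum may be computed along any exhaustion. *)
Lemma has_csum_cvg (R : realType) (I : eqType) (u : I -> R[i]) (L : R[i])
    (S : nat -> seq I) b : has_csum u L ->
  (forall n, uniq (S n)) -> (forall n, {subset S n <= S n.+1}) ->
  (forall i, exists n, i \in S n) ->
  part b (\sum_(i <- S n) u i) @[n --> \oo] --> part b L.
Proof.
move=> uL uS nS eS.
have fS (s : seq I) : exists n, {subset s <= S n}.
  elim: s => [|i s [n IH]]; first by exists 0%N.
  have [m im] := eS i; exists (maxn m n) => j; rewrite inE => /orP[/eqP ->|/IH].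
    exact: (nested_le nS (leq_maxl m n)).
  exact: (nested_le nS (leq_maxr m n)).
apply/cvgrPdist_le => eps e0; have [s0 h] := uL _ e0; have [N sN] := fS s0.
exists N => // n /= Nn; rewrite distrC.
have -> : part b (\sum_(i <- S n) u i) - part b L =
    part b (\sum_(i <- S n) u i - L).
  by rewrite partD; congr (_ + _); case: b; case: (L).
apply: le_trans (ler_part _ _) _; apply: h => // i /sN.
exact: nested_le.
Qed.

Section tensor_series.
Context d1 d2 (T1 : measurableType d1) (T2 : measurableType d2) (R : realType).
Variables (mu1 : {finite_measure set T1 -> \bar R})
          (mu2 : {finite_measure set T2 -> \bar R}).
Variables (Y1 Y2 : eqType) (e1 : Y1 -> T1 -> R[i]) (e2 : Y2 -> T2 -> R[i]).
Variables (V1 V2 : R).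
Hypotheses (oe1 : orthogonal_system mu1 e1 V1) (oe2 : orthogonal_system mu2 e2 V2).
Variables (I : countType) (y1 : I -> Y1) (y2 : I -> Y2).
Variables (r : I -> R) (c : I -> R[i]) (A B : R).
Hypotheses (r0 : forall i, 0 <= r i) (A0 : 0 <= A)
  (rA : forall y, sums_le (fun i => if (y1 i, y2 i) == y then r i ^+ 2 else 0) A)
  (cB : sums_le (fun i => sqabs (c i)) B).

(** The coefficients of F are asserted slice by slice: for almost every t the
    function F(t, .) has on e2_y the coefficient given by the series over all
    indices i with y2 i = y, whenever that series converges. Basis functions
    sharing the same pair (y1, y2) are handled by Schur's test. *)
Theorem tensor_series : exists F : T1 * T2 -> R[i],
  [/\ memL2 (finite_product mu1 mu2) F,
      (energy (finite_product mu1 mu2) F <= (V1 * V2 * (A * B))%:E)%E &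
      {ae mu1, forall t, forall y L,
        has_csum (fun i => if y2 i == y then (r i)%:C * c i * e1 (y1 i) t else 0) L ->
        cintegral mu2 (fun z => F (t, z) * conjc (e2 y z)) = V2%:C * L}].
Proof.
have B0 : 0 <= B by have := cB (s := [::]) isT; rewrite big_nil.
have [S [[uS nS eS tS] S0]] := sums_le_exhaustion cB B0.
have oe := orthogonal_tensor oe1 oe2.
pose y i := (y1 i, y2 i); pose a i := (r i)%:C * c i.
pose e := tensor e1 e2.
have schur s : uniq s ->
    (energy (finite_product mu1 mu2) (trig_sum e s y a) <=
     (V1 * V2 * (A * \sum_(i <- s) sqabs (c i)))%:E)%E.
  by move=> us; rewrite (energy_trig _ _ _ oe) lee_fin; exact: (trig_schur oe).
have V0 : 0 <= V1 * V2 by case: oe => /ltW.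
pose q n := trig_sum e (increment S n) y a.
have mq n : cmeasurable (q n) by exact: (cmeasurable_trig oe).
have qK n : (energy (finite_product mu1 mu2) (q n) <=
    (V1 * V2 * (A * (B + 1)) * 4^-1 ^+ n)%:E)%E.
  apply: le_trans (schur _ (increment_uniq uS n)) _; rewrite lee_fin.
  rewrite -[leRHS]mulrA -[X in _ <= _ * X]mulrA; do 2 apply: ler_wpM2l => //.
  apply: tS.
    exact: increment_uniq.
  exact: increment_disjoint.
have QE n x : partial_sum q n x = trig_sum e (S n) y a x.
  elim: n => [|n IH]; first by rewrite /partial_sum big_ord0 S0 /trig_sum big_nil.
  by rewrite /partial_sum big_ord_recr/= -/(partial_sum q n x) IH /trig_sum (sum_increment uS nS).
have EF : (energy (finite_product mu1 mu2) (limit_fun q) <= (V1 * V2 * (A * B))%:E)%E.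
  apply: energy_limit_fun => // n.
  have -> : partial_sum q n = trig_sum e (S n) y a by apply/funext; exact: QE.
  apply: le_trans (schur _ (uS n)) _; rewrite lee_fin.
  by do 2 apply: ler_wpM2l => //; exact: cB.
exists (limit_fun q); split=> //.
  apply/memL2P; split; first exact: cmeasurable_limit_fun.
  exact: le_lt_trans EF (ltry _).
have := ae_slice_dominant mq qK; apply: filterS => t iG y0 L hL.
have [V20 m2 n2 o2] := oe2.
have h1 z : Normc.normc (conjc (e2 y0 z)) = 1.
  by rewrite normc_sqrt sqabs_conjc n2 sqrtr1.
have P b : part b (cintegral mu2 (fun z => limit_fun q (t, z) * conjc (e2 y0 z))) =
    part b (V2%:C * L).
  have c1 := @slice_cvg _ _ _ _ _ _ _ mq b t _ iG (cmeasurable_conj (m2 y0)) h1.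
  have c2 : part b (V2%:C * \sum_(i <- S n)
      (if y2 i == y0 then a i * e1 (y1 i) t else 0)) @[n --> \oo] --> part b (V2%:C * L).
    rewrite (mulrC _ L); under eq_fun do rewrite mulrC.
    by apply: part_mul_cvg => b'; exact: has_csum_cvg.
  have E n : \int[mu2]_z part b (partial_sum q n (t, z) * conjc (e2 y0 z)) =
      part b (V2%:C * \sum_(i <- S n) (if y2 i == y0 then a i * e1 (y1 i) t else 0)).
    rewrite -big_mkcond -(trig_coef oe2 (S n) y2 (fun i => a i * e1 (y1 i) t) y0).
    have trE z : partial_sum q n (t, z) =
        trig_sum e2 (S n) y2 (fun i => a i * e1 (y1 i) t) z.
      by rewrite QE; apply: eq_bigr => i _; rewrite /e /tensor mulrA.
    by case: b {c1 c2}; apply: eq_Rintegral => z _; rewrite trE.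
  move: c1; under eq_fun do rewrite E.
  move=> c1; have := cvg_unique _ c1 c2.
  by case: b {c1 c2 E} => <-.
by apply: complexP; [exact: (P true)|exact: (P false)].
Qed.

End tensor_series.

(** * Unordered sums of complex families *)

Section has_csum_algebra.
Variable R : realType.

Lemma has_csumD (I : eqType) (u v : I -> R[i]) K L : has_csum u K -> has_csum v L ->
  has_csum (fun i => u i + v i) (K + L).
Proof.
move=> hu hv eps e0; have e2 : 0 < eps / 2 by rewrite divr_gt0.
have [s hs] := hu _ e2; have [t ht] := hv _ e2.
exists (s ++ t) => w uw stw; rewrite big_split /= opprD addrACA.
apply: le_trans (ler_normcD _ _) _; rewrite [leRHS]splitr; apply: lerD.
  by apply: hs => // i iS; apply: stw; rewrite mem_cat iS.
by apply: ht => // i iS; apply: stw; rewrite mem_cat iS orbT.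
Qed.

Lemma has_csumZ (I : eqType) (k : R[i]) (u : I -> R[i]) L : has_csum u L ->
  has_csum (fun i => k * u i) (k * L).
Proof.
move=> hu eps e0; have k0 : 0 < Normc.normc k + 1.
  by rewrite ltr_wpDl ?normc_ge0.
have [s hs] := hu (eps / (Normc.normc k + 1)) (divr_gt0 e0 k0).
exists s => w uw sw; rewrite -mulr_sumr -mulrBr Normc.normcM.
apply: (@le_trans _ _ ((Normc.normc k + 1) * (eps / (Normc.normc k + 1)))); last first.
  by rewrite mulrC divfK ?gt_eqF.
by rewrite ler_pM ?normc_ge0 ?lerDl// hs.
Qed.

Lemma eq_has_csum (I : eqType) (u v : I -> R[i]) L : u =1 v -> has_csum u L -> has_csum v L.
Proof. by move=> /funext ->. Qed.

(** Extension by zero along an injection h, whose partial inverse g tells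
    whether an index is in the image. *)
Lemma has_csum_inj (I J : eqType) (h : I -> J) (g : J -> option I) (u : I -> R[i]) L :
  pcancel h g -> ocancel g h -> has_csum u L ->
  has_csum (fun j => if g j is Some i then u i else 0) L.
Proof.
move=> hg gh hu eps e0; have [s hs] := hu _ e0.
exists (map h s) => w uw sw.
have -> : \sum_(j <- w) (if g j is Some i then u i else 0) = \sum_(i <- pmap g w) u i.
  elim: w {uw sw} => [|j w IH]; first by rewrite !big_nil.
  by rewrite big_cons IH /=; case: (g j) => [i|] /=; rewrite ?big_cons ?add0r.
apply: hs.
  exact: (pmap_uniq gh).
move=> i iS; rewrite mem_pmap; apply/mapP; exists (h i); last by rewrite hg.
exact/sw/map_f.
Qed.
End has_csum_algebra.

Section esum_sums_le.
Variables (R : realType) (I : choiceType).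

Lemma esum_le (w : I -> R) (C : R) : (forall i, 0 <= w i) -> sums_le w C ->
  (\esum_(i in [set: I]) (w i)%:E <= C%:E)%E.
Proof.
move=> w0 wC; apply: ge_ereal_sup => _ [A [fA _] <-].
rewrite fsbig_finite//= sumEFin lee_fin; apply: wC; exact: finmap.fset_uniq.
Qed.

Lemma esum_has_sum (w : I -> R) (C eps : R) : (forall i, 0 <= w i) -> sums_le w C ->
  0 < eps -> exists s0 : seq I, forall s, uniq s -> {subset s0 <= s} ->
    `|\sum_(i <- s) w i - fine (\esum_(i in [set: I]) (w i)%:E)| <= eps.
Proof.
move=> w0 wC e0; set E := (\esum_(i in _) _)%E.
have Efin : E \is a fin_num.
  rewrite ge0_fin_numE; last by apply: esum_ge0 => i _; rewrite lee_fin.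
  exact: le_lt_trans (esum_le w0 wC) (ltry _).
have up s : uniq s -> \sum_(i <- s) w i <= fine E.
  move=> us; rewrite -lee_fin fineK// -sumEFin; apply: esum_ge.
  exists [set` s]; first by split.
  by rewrite fsbig_seq.
have [_ [A [fA _] <-]] := ub_ereal_sup_adherent e0 Efin.
rewrite -/E fsbig_finite//= sumEFin => h.
exists (finmap.enum_fset (fset_set A)) => s us ss.
rewrite distrC ger0_norm ?subr_ge0 ?up// lerBlDr -lerBlDl.
apply: le_trans (ler_sum_subset w0 (finmap.fset_uniq _) ss).
rewrite -lee_fin EFinB fineK//; exact: ltW.
Qed.

Lemma sums_le_csummable (u : I -> R[i]) (C : R) :
  sums_le (fun i => Normc.normc (u i)) C -> csummable u.
Proof.
move=> h; rewrite /csummable /summable.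
apply: le_lt_trans (ltry C); apply: le_trans (esum_le _ h); last first.
  by move=> i; exact: normc_ge0.
by apply: le_esum => i _; rewrite /= ger0_norm ?normc_ge0.
Qed.

Lemma rsum_has_sum (v : I -> R) (C eps : R) : sums_le (fun i => `|v i|) C ->
  0 < eps -> exists s0 : seq I, forall s, uniq s -> {subset s0 <= s} ->
    `|\sum_(i <- s) v i - rsum v| <= eps.
Proof.
move=> vC e0.
pose vp i := Num.max (v i) 0; pose vn i := Num.max (- v i) 0.
have vp0 i : 0 <= vp i by rewrite /vp le_max lexx orbT.
have vn0 i : 0 <= vn i by rewrite /vn le_max lexx orbT.
have vE i : v i = vp i - vn i.
  rewrite /vp /vn; have [h|h] := orP (le_total 0 (v i)).
    by rewrite (max_idPl h) (max_idPr _) ?oppr_le0// subr0.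
  by rewrite (max_idPr h) (max_idPl _) ?oppr_ge0// sub0r opprK.
have vpC : sums_le vp C by apply: sums_le_mono vC => i; rewrite /vp ge_max normr_ge0 ler_norm.
have vnC : sums_le vn C by apply: sums_le_mono vC => i; rewrite /vn ge_max normr_ge0 -normrN ler_norm.
have rE : rsum v = fine (\esum_(i in [set: I]) (vp i)%:E)%E - fine (\esum_(i in [set: I]) (vn i)%:E)%E.
  rewrite /rsum; congr (fine _ - fine _); apply: eq_esum => i _ /=.
    by rewrite funeposE /vp EFin_max.
  by rewrite funenegE /vn EFin_max.
have e2 : 0 < eps / 2 by rewrite divr_gt0.
have [s1 h1] := esum_has_sum vp0 vpC e2; have [s2 h2] := esum_has_sum vn0 vnC e2.
exists (s1 ++ s2) => s us ss; rewrite rE.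
under eq_bigr do rewrite vE.
have E (x y a b : R) : x - y - (a - b) = (x - a) - (y - b) by ring.
rewrite sumrB E.
rewrite [leRHS]splitr; apply: le_trans (ler_normB _ _) (lerD _ _).
  by apply: h1 => // i iS; apply: ss; rewrite mem_cat iS.
by apply: h2 => // i iS; apply: ss; rewrite mem_cat iS orbT.
Qed.

(** The real and imaginary parts are differences of two nonnegative families,
    for which the extended sum is the supremum of the finite partial sums. *)
Lemma csum_has_csum (u : I -> R[i]) (C : R) :
  sums_le (fun i => Normc.normc (u i)) C -> has_csum u (csum u).
Proof.
move=> uC eps e0; have e2 : 0 < eps / 2 by rewrite divr_gt0.
have [s1 h1] := rsum_has_sum (sums_le_mono (fun i => ler_Re_normc (u i)) uC) e2.
have [s2 h2] := rsum_has_sum (sums_le_mono (fun i => ler_Im_normc (u i)) uC) e2.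
exists (s1 ++ s2) => s us ss; apply: le_trans (normc_le_ReIm _) _.
have -> : complex.Re (\sum_(i <- s) u i - csum u) =
  \sum_(i <- s) complex.Re (u i) - rsum (fun i => complex.Re (u i)).
  by rewrite cReD cRe_sum.
have -> : complex.Im (\sum_(i <- s) u i - csum u) =
  \sum_(i <- s) complex.Im (u i) - rsum (fun i => complex.Im (u i)).
  by rewrite cImD cIm_sum.
rewrite [leRHS]splitr; apply: lerD.
  by apply: h1 => // i iS; apply: ss; rewrite mem_cat iS.
by apply: h2 => // i iS; apply: ss; rewrite mem_cat iS orbT.
Qed.
End esum_sums_le.

(** * The frequencies read by a collision *)

Section weights.
Variables (R : realType) (al : R).

Lemma bracket_gt0 (n : Z3) : 0 < bracket al n.
Proof. by rewrite powR_gt0// vec_weight_base_gt0. Qed.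

Lemma bracket_vec_weight (n : Z3) : bracket al n ^- 2 = vec_weight al n.
Proof.
rewrite /bracket -powR_mulrn ?powR_ge0// -powRrM /vec_weight powRN; congr (_ `^ _)^-1.
by field.
Qed.

Definition sobolev_weight k (n n' : freq k) : R :=
  \prod_(j < k) (bracket al (tnth n j) * bracket al (tnth n' j)).

Lemma sobolev_weight_gt0 k (n n' : freq k) : 0 < sobolev_weight n n'.
Proof. by apply: prodr_gt0 => j _; rewrite mulr_gt0 ?bracket_gt0. Qed.

Lemma tnth_rcons_widen k (n : freq k) m (i : 'I_k) :
  tnth (rcons_freq n m) (widen_ord (leqnSn k) i) = tnth n i.
Proof. by rewrite !(tnth_nth 0) /= nth_rcons size_tuple ltn_ord. Qed.

Lemma tnth_rcons_max k (n : freq k) m : tnth (rcons_freq n m) ord_max = m.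
Proof. by rewrite (tnth_nth 0) /= nth_rcons size_tuple ltnn eqxx. Qed.

Lemma tnth_shift k (j : 'I_k) v (n : freq k) i :
  tnth (shift_freq j v n) i = if i == j then tnth n i + v else tnth n i.
Proof. by rewrite tnth_mktuple. Qed.

Lemma sobolev_weight_rcons k (n n' : freq k) p q :
  sobolev_weight (rcons_freq n p) (rcons_freq n' q) =
  sobolev_weight n n' * (bracket al p * bracket al q).
Proof.
rewrite /sobolev_weight big_ord_recr !tnth_rcons_max; congr (_ * _).
by apply: eq_bigr => i _; rewrite !tnth_rcons_widen.
Qed.

Lemma sobolev_weight_sym k (n n' : freq k) : sobolev_weight n n' = sobolev_weight n' n.
Proof. by apply: eq_bigr => i _; rewrite mulrC. Qed.

Lemma sobolev_weight_shift k (n n' : freq k) j v :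
  sobolev_weight (shift_freq j v n) n' * bracket al (tnth n j) =
  sobolev_weight n n' * bracket al (tnth n j + v).
Proof.
rewrite /sobolev_weight (bigD1 j)//= [in RHS](bigD1 j)//= tnth_shift eqxx.
rewrite (eq_bigr (fun i => bracket al (tnth n i) * bracket al (tnth n' i))); first by ring.
by move=> i /negbTE ij; rewrite tnth_shift ij.
Qed.

Lemma sqnorm_rcons k (n : freq k) p : sqnorm (rcons_freq n p) = sqnorm n + sqnorm3 p.
Proof.
rewrite /sqnorm big_ord_recr tnth_rcons_max; congr (_ + _).
by apply: eq_bigr => i _; rewrite tnth_rcons_widen.
Qed.

Lemma sqnorm_shift k (n : freq k) j v :
  sqnorm (shift_freq j v n) = sqnorm n - sqnorm3 (tnth n j) + sqnorm3 (tnth n j + v).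
Proof.
rewrite /sqnorm (bigD1 j)//= [X in _ = X - _ + _](bigD1 j)//= tnth_shift eqxx.
rewrite (eq_bigr (fun i => sqnorm3 (tnth n i))); first by ring.
by move=> i /negbTE ij; rewrite tnth_shift ij.
Qed.

Lemma rcons_freq_inj k (n m : freq k) p q :
  rcons_freq n p = rcons_freq m q -> n = m /\ p = q.
Proof.
move=> /(congr1 val) /= /rcons_inj [nm ->]; split=> //; exact: val_inj.
Qed.

Lemma shift_freq_inj k (j : 'I_k) v : injective (@shift_freq k j v).
Proof.
move=> n m nm; apply: eq_from_tnth => i.
have := congr1 (fun n => tnth n i) nm; rewrite !tnth_shift.
by case: ifP => // _ /addIr.
Qed.

End weights.

Section source.
Variables (R : realType) (k : nat) (j : 'I_k).

(** B^+ is selected by true and B^- by false; pq is the summation variable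
    (n_(k+1), n'_(k+1)) and y = (n, n') the output frequency. *)
Definition source (b : bool) (y : freq k * freq k) (pq : Z3 * Z3) :
    freq k.+1 * freq k.+1 :=
  if b then (rcons_freq (shift_freq j (pq.2 - pq.1) y.1) pq.1, rcons_freq y.2 pq.2)
  else (rcons_freq y.1 pq.1, rcons_freq (shift_freq j (pq.1 - pq.2) y.2) pq.2).

(** Distinct terms of the collision series read distinct coefficients, so the
    square sum of what is read does not exceed that of gamma^(k+1). *)
Lemma source_inj b : injective (fun x : (freq k * freq k) * (Z3 * Z3) => source b x.1 x.2).
Proof.
move=> [[n n'] [p q]] [[m m'] [p' q']] /= E.
have := congr1 fst E; have := congr1 snd E; rewrite /source {E}; case: b => /=.
  move=> /rcons_freq_inj[-> ->] /rcons_freq_inj[h pp]; rewrite pp in h *.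
  by rewrite (shift_freq_inj h).
move=> /rcons_freq_inj[h qq] /rcons_freq_inj[-> pp]; rewrite pp qq in h *.
by rewrite (shift_freq_inj h).
Qed.

(** The frequency in time of the term under the free evolution. *)
Definition source_time b y pq : int :=
  sqnorm (source b y pq).1 - sqnorm (source b y pq).2.

(** What remains of the weight S^(k,alpha) of the output once the coefficient
    that is read has been multiplied by its own weight S^(k+1,alpha). *)
Definition gain (al : R) b y pq : R := sobolev_weight al y.1 y.2 /
  sobolev_weight al (source b y pq).1 (source b y pq).2.

(** The frequency n_j or n'_j altered by the collision. *)
Definition node (b : bool) (y : freq k * freq k) : Z3 := if b then tnth y.1 j else tnth y.2 j.

(** For B^- the two summation variables exchange roles; after this exchange
    both operators lead to the same lattice sum. *)
Definition orient (b : bool) (pq : Z3 * Z3) : Z3 * Z3 := if b then pq else (pq.2, pq.1).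

Lemma orient_inj b : injective (orient b).
Proof. by case: b => // -[p q] [p' q'] [-> ->]. Qed.

Lemma gain_ge0 al b y pq : 0 <= gain al b y pq.
Proof. by rewrite divr_ge0// ltW// sobolev_weight_gt0. Qed.

(** All the factors of the weights that are not touched by the collision
    cancel. *)
Lemma gain_sqr al b y pq : let x := orient b pq in let n := node b y in
  gain al b y pq ^+ 2 = vec_weight al (n + (x.2 - x.1)) * vec_weight al x.1 * vec_weight al x.2 / vec_weight al n.
Proof.
have key (n n' : freq k) p q : sobolev_weight al n n' /
    sobolev_weight al (rcons_freq (shift_freq j (q - p) n) p) (rcons_freq n' q) =
    bracket al (tnth n j) / (bracket al (tnth n j + (q - p)) * bracket al p * bracket al q).
  rewrite sobolev_weight_rcons.
  have E := sobolev_weight_shift al n n' j (q - p).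
  have B0 m := gt_eqF (bracket_gt0 al m).
  have S0 := gt_eqF (sobolev_weight_gt0 al (shift_freq j (q - p) n) n').
  have -> : sobolev_weight al n n' = sobolev_weight al (shift_freq j (q - p) n) n' *
      bracket al (tnth n j) / bracket al (tnth n j + (q - p)).
    by rewrite E mulfK// B0.
  by field; rewrite !B0 S0.
have sq (a b' c d : Z3) : (bracket al a / (bracket al b' * bracket al c * bracket al d)) ^+ 2 =
    vec_weight al b' * vec_weight al c * vec_weight al d / vec_weight al a.
  rewrite -!bracket_vec_weight; field; by rewrite !gt_eqF ?bracket_gt0.
case: y pq => [n n'] [p q]; rewrite /gain /source /orient /node; case: b => /=.
  by rewrite key sq.
by rewrite sobolev_weight_sym [X in _ / X]sobolev_weight_sym key sq.
Qed.

(** For a fixed output frequency, prescribing the frequency in time amounts to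
    prescribing |a|^2 + |b|^2 - |c|^2. *)
Lemma source_time_fiber b y pq m : source_time b y pq = m ->
  let x := orient b pq in let n := node b y in
  sqnorm3 (n + (x.2 - x.1)) + sqnorm3 x.1 - sqnorm3 x.2 =
  (if b then m else - m) - (if b then sqnorm y.1 - sqnorm y.2 else sqnorm y.2 - sqnorm y.1)
    + sqnorm3 n.
Proof.
move=> <-; case: y pq => [n n'] [p q]; rewrite /source_time /source /orient /node.
by case: b => /=; rewrite !sqnorm_rcons sqnorm_shift; ring.
Qed.

End source.

(** * Summability of the collision terms *)

Section systems.
Variable R : realType.

Lemma twopi_gt0 : 0 < 2 * pi :> R.
Proof. by rewrite mulr_gt0// pi_gt0. Qed.

Lemma volume_gt0 k : 0 < volume R k.
Proof. by rewrite mulr_gt0// !exprn_gt0// twopi_gt0. Qed.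

Lemma volumeS k : volume R k.+1 = (2 * pi) ^+ 6 * volume R k.
Proof. by rewrite /volume !exprS; ring. Qed.

Lemma character_system k :
  orthogonal_system (kernel_measure R k) (@character R k) (volume R k).
Proof.
split; [exact: volume_gt0|exact: cmeasurable_character|by move=> *; exact: sqabs_cis|].
exact: cintegral_character.
Qed.

Definition time_wave (m : int) (t : measurableTypeR R) : R[i] := cis (- t * m%:~R).

Lemma time_system : orthogonal_system (period_measure R) time_wave (2 * pi).
Proof.
split; [exact: twopi_gt0| |by move=> *; exact: sqabs_cis|].
  move=> m; apply: cmeasurable_cis; apply: measurable_funM => //.
move=> m m'; rewrite /time_wave.
transitivity (cintegral (period_measure R) (fun t => cis ((m' - m)%:~R * t))).
  by apply: eq_cintegral => t; rewrite -cisN -cisD intrB; congr cis; ring.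
by rewrite cintegral_period_cis subr_eq0 eq_sym.
Qed.

Lemma fourierE k (f : kernel_fun R k) n n' :
  fourier f n n' = cintegral (kernel_measure R k)
    (fun z => f z * conjc (character (n, n') z)).
Proof.
by apply: eq_cintegral => z; rewrite /character -cisN opprB addrC.
Qed.
End systems.

Section summability.
Variables (R : realType) (al : R).
Hypothesis al1 : 1 < al.

(** The hypothesis of Schur's test. The index i = (b, (y, pq)) gathers the terms
    of both operators, whence the two copies of A. *)
Lemma gain_fiber_sum : exists2 A : R, 0 <= A & forall k (j : 'I_k) (y : int * (freq k * freq k)),
  sums_le (fun i : bool * ((freq k * freq k) * (Z3 * Z3)) =>
    if (source_time j i.1 i.2.1 i.2.2, i.2.1) == y
    then gain j al i.1 i.2.1 i.2.2 ^+ 2 else 0) (A + A).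
Proof.
have [A A0 hA] := resonant_lattice_sum al1; exists A => // k j [m y].
pose P b (i : bool * ((freq k * freq k) * (Z3 * Z3))) :=
  [&& i.1 == b, source_time j i.1 i.2.1 i.2.2 == m & i.2.1 == y].
pose tau b := (if b then m else - m) -
  (if b then sqnorm y.1 - sqnorm y.2 else sqnorm y.2 - sqnorm y.1) + sqnorm3 (node j b y).
pose f b (x : Z3 * Z3) :=
    if sqnorm3 (node j b y + (x.2 - x.1)) + sqnorm3 x.1 - sqnorm3 x.2 == tau b
    then vec_weight al (node j b y + (x.2 - x.1)) * vec_weight al x.1 * vec_weight al x.2 / vec_weight al (node j b y) else 0.
have f0 b x : 0 <= f b x.
  by rewrite /f; case: ifP => // _; rewrite divr_ge0 ?mulr_ge0 ?vec_weight_ge0.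
apply: (@sums_le_mono _ _ _ (fun i => (if P true i then f true (orient true i.2.2) else 0) +
   (if P false i then f false (orient false i.2.2) else 0))).
  move=> [b [y' pq]] /=; rewrite /P /= xpair_eqE.
  case: eqP => [tE|_] /=; last by rewrite !andbF addr0.
  case: eqP => [yE|_] /=; last by rewrite !andbF addr0.
  have := source_time_fiber tE; rewrite yE => h.
  by case: b tE h => tE h; rewrite gain_sqr /f /= ?addr0 ?add0r {1}h eqxx.
have iP b : {in P b &, injective (fun i => orient b i.2.2)}.
  move=> [b1 [y1 pq1]] [b2 [y2 pq2]] /and3P[/eqP /= -> _ /eqP ->].
  by move=> /and3P[/eqP /= -> _ /eqP ->] /orient_inj ->.
apply: sums_leD; apply: (sums_le_inj (h := fun i : bool * ((freq k * freq k) * (Z3 * Z3)) =>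
  orient _ i.2.2) _ (iP _)) => //; exact: hA.
Qed.

Lemma gain_sum k (j : 'I_k) b y : exists C : R, sums_le (fun pq => gain j al b y pq ^+ 2) C.
Proof.
have [C hC] := unconstrained_sum al1.
exists ((vec_weight al (node j b y))^-1 * C).
pose g (x : Z3 * Z3) := (vec_weight al (node j b y))^-1 *
  (vec_weight al (node j b y + (x.2 - x.1)) * vec_weight al x.1 * vec_weight al x.2).
apply: (@sums_le_mono _ _ _ (fun pq => g (orient b pq))).
  by move=> pq; rewrite gain_sqr /g mulrC.
apply: (sums_le_injT (f := g)); first exact: orient_inj.
by apply: sums_leZ => //; rewrite invr_ge0 vec_weight_ge0.
Qed.

Variables (k : nat) (j : 'I_k) (c : fcoeff R k.+1) (B : R).
Hypothesis dB : sums_le (fun y => sqabs (sobolev al c y.1 y.2)) B.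

Definition collision_term (b : bool) (c : fcoeff R k.+1) (y : freq k * freq k) (pq : Z3 * Z3) :=
  if b then collision_plus_term j c y.1 y.2 pq else collision_minus_term j c y.1 y.2 pq.

Lemma collision_termE b c' y pq : collision_term b c' y pq =
  c' (source j b y pq).1 (source j b y pq).2.
Proof. by case: b. Qed.

Lemma sobolevE k' (c' : fcoeff R k') n n' :
  sobolev al c' n n' = (sobolev_weight al n n')%:C * c' n n'.
Proof. by []. Qed.

(** 2 |x| <= s^2 |x|^2 + s^(-2), where s is the weight of the coefficient x that
    is read: the first terms are square summable by hypothesis and the second
    ones are summed by [unconstrained_sum]. *)
Lemma collision_term_sum b y t : exists C,
  sums_le (fun pq => Normc.normc (collision_term b (free_evolution t c) y pq)) C.
Proof.
have [C hC] := gain_sum j b y.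
pose w := sobolev_weight al y.1 y.2.
have w0 : 0 < w by exact: sobolev_weight_gt0.
exists (2^-1 * (B + w ^- 2 * C)).
apply: (@sums_le_mono _ _ _ (fun pq => 2^-1 * (sqabs (sobolev al c (source j b y pq).1 (source j b y pq).2) +
   w ^- 2 * gain j al b y pq ^+ 2))).
  move=> pq; rewrite collision_termE /free_evolution Normc.normcM normc_cis mul1r.
  rewrite sobolevE sqabsM /gain -/w.
  set s := sobolev_weight _ _ _; set x := c _ _.
  have s0 : 0 < s by exact: sobolev_weight_gt0.
  have -> : w ^- 2 * (w / s) ^+ 2 = s ^- 2 by field; rewrite !gt_eqF.
  have := normc_amgm x (exprn_gt0 2 s0).
  have -> : sqabs s%:C = s ^+ 2 by rewrite /sqabs /= expr0n addr0.
  by rewrite addrC.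
apply: sums_leZ; first by rewrite invr_ge0.
apply: sums_leD; last by apply: sums_leZ => //; rewrite invr_ge0 exprn_ge0// ltW.
apply: (sums_le_injT (h := fun pq => source j b y pq)
  (f := fun x => sqabs (sobolev al c x.1 x.2))) => //.
by move=> pq pq' E; have [] := @source_inj k j b (y, pq) (y, pq') E.
Qed.

End summability.

(** * The spacetime estimate *)

Section assembly.
Variables (R : realType) (al A : R).
Hypotheses (al1 : 1 < al) (A0 : 0 <= A).
Variables (k : nat) (j : 'I_k).
Local Notation freq2 := (freq k * freq k)%type.
Local Notation I := (bool * (freq2 * (Z3 * Z3)))%type.
Hypothesis gA : forall y : int * freq2, sums_le (fun i : I =>
    if (source_time j i.1 i.2.1 i.2.2, i.2.1) == y
    then gain j al i.1 i.2.1 i.2.2 ^+ 2 else 0) A.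
Variables (c : fcoeff R k.+1) (f : kernel_fun R k.+1).
Hypotheses (f2 : memL2 (kernel_measure R k.+1) f) (fc : fourier f = sobolev al c).

Let E0 : R := \int[kernel_measure R k.+1]_x sqabs (f x).
Let B : R := volume R k.+1 * E0.

Lemma sobolev_square_sum : sums_le (fun y => sqabs (sobolev al c y.1 y.2)) B.
Proof.
have := bessel (@character_system R k.+1) f2; apply: sums_le_mono => -[n n'] /=.
by rewrite -fc fourierE.
Qed.

(** The factor (2 pi)^(-6) comes from the collision operator, the inverse of the
    volume from Fourier inversion. *)
Definition norm_const : R := (volume R k)^-1 * (2 * pi) ^- 6.

Definition coef (i : I) : R[i] := (norm_const * (if i.1 then 1 else -1))%:C *
  sobolev al c (source j i.1 i.2.1 i.2.2).1 (source j i.1 i.2.1 i.2.2).2.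

Lemma coef_square_sum : sums_le (fun i => sqabs (coef i)) (norm_const ^+ 2 * (B + B)).
Proof.
pose d (y : freq k.+1 * freq k.+1) := sqabs (sobolev al c y.1 y.2).
apply: (@sums_le_mono _ _ _ (fun i : I => norm_const ^+ 2 *
  ((if i.1 == true then d (source j true i.2.1 i.2.2) else 0) +
   (if i.1 == false then d (source j false i.2.1 i.2.2) else 0)))).
  move=> [b [y pq]]; rewrite /coef sqabsM [X in X * _](_ : _ = norm_const ^+ 2).
    by case: b; rewrite /= /d ?addr0 ?add0r.
  by case: b; rewrite /sqabs /=; ring.
apply: sums_leZ; first exact: sqr_ge0.
have iP b : {in (fun i : I => i.1 == b) &, injective (fun i : I => source j b i.2.1 i.2.2)}.
  by move=> [b1 x1] [b2 x2] /eqP /= -> /eqP /= -> /(@source_inj k j b x1 x2) ->.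
have d0 y : 0 <= d y by exact: sqabs_ge0.
by apply: sums_leD; apply: (sums_le_inj _ (iP _)) => //; exact: sobolev_square_sum.
Qed.

Definition collision_coef t (y : freq2) : R[i] :=
  (norm_const * sobolev_weight al y.1 y.2)%:C *
  (csum (collision_term j true (free_evolution t c) y) -
   csum (collision_term j false (free_evolution t c) y)).

Lemma has_csum_collision t y : has_csum (fun i : I =>
  if i.2.1 == y then (gain j al i.1 i.2.1 i.2.2)%:C * coef i *
    time_wave (source_time j i.1 i.2.1 i.2.2) t else 0) (collision_coef t y).
Proof.
pose u b := collision_term j b (free_evolution t c) y.
have hu b : has_csum (u b) (csum (u b)).
  by have [C hC] := collision_term_sum al1 j sobolev_square_sum b y t; exact: csum_has_csum hC.
pose h b (pq : Z3 * Z3) : I := (b, (y, pq)).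
pose g b (i : I) := if (i.1 == b) && (i.2.1 == y) then Some i.2.2 else None.
have hg b : pcancel (h b) (g b) by move=> pq; rewrite /g /= !eqxx.
have gh b : ocancel (g b) (h b).
  by move=> [b' [y' pq]]; rewrite /g /=; case: andP => //= -[/eqP -> /eqP ->].
have H b := has_csum_inj (hg b) (gh b) (hu b).
have := has_csumZ (norm_const * sobolev_weight al y.1 y.2)%:C
  (has_csumD (H true) (has_csumZ (-1) (H false))).
rewrite mulN1r; apply: eq_has_csum => -[b [y' pq]]; rewrite /g /=.
case: (eqVneq y' y) => [->|_]; last by rewrite !andbF !mulr0 addr0 mulr0.
have sE x : sobolev_weight al y.1 y.2 * x = x * sobolev_weight al y.1 y.2 by rewrite mulrC.
have main : (norm_const * sobolev_weight al y.1 y.2)%:C * u b pq =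
    (gain j al b y pq)%:C * (norm_const%:C *
     sobolev al c (source j b y pq).1 (source j b y pq).2) *
    time_wave (source_time j b y pq) t.
  rewrite /u collision_termE /free_evolution sobolevE /time_wave /source_time /gain.
  set s := sobolev_weight al (source _ _ _ _).1 _; set w := sobolev_weight _ _ _.
  have s0 : s != 0 by rewrite gt_eqF// sobolev_weight_gt0.
  have -> : (norm_const * w)%:C = (w / s)%:C * norm_const%:C * s%:C.
    by rewrite -!rmorphM; congr _%:C; field.
  by ring.
case: b main => main; rewrite /= ?eqxx /= ?mulr0 ?addr0 ?add0r ?mulN1r ?mulrN.
  by rewrite main /coef /= mulr1.
by rewrite main /coef /= mulrN1 rmorphN !(mulNr, mulrN).
Qed.

Lemma sobolev_collision t y : (volume R k)%:C * collision_coef t y =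
  sobolev al (collision j (free_evolution t c)) y.1 y.2.
Proof.
rewrite sobolevE /collision_coef /collision /collision_plus /collision_minus.
set X := csum _; set Y := csum _.
have -> : (2 * pi) ^- 6 = volume R k * norm_const.
  by rewrite /norm_const mulrA divff ?mul1r// gt_eqF// volume_gt0.
rewrite -[X in _ = _ * (_ * X - _)]/X -[X in _ = _ * (_ - _ * X)]/Y.
by rewrite !(rmorphM (real_complex R)) /=; ring.
Qed.

(** The constant does not depend on k: the volume of Lambda^(k+1) x Lambda^(k+1)
    brought in by Bessel's inequality is (2 pi)^6 times that of
    Lambda^k x Lambda^k, which is divided out by the normalisation of the
    coefficients of F. *)
Lemma spacetime_bound : (L2norm_spacetime (fun t : R =>
    sobolev al (collision j (free_evolution t c))) <=
  (Num.sqrt (2 * A * (2 * pi) ^- 5))%:E * L2norm (kernel_measure R k.+1) f)%E.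
Proof.
have [F [F2 FE Fc]] := tensor_series (time_system R) (@character_system R k)
  (fun i : I => gain_ge0 j al i.1 i.2.1 i.2.2) A0 gA coef_square_sum.
apply: (@le_trans _ _ (L2norm (spacetime_measure R k) F)).
  apply: ereal_inf_lbound; exists F => //; split=> //.
  apply: filterS Fc => t Ft; apply/funext => n; apply/funext => n'.
  rewrite fourierE (Ft (n, n') _ (has_csum_collision t (n, n'))).
  exact: (sobolev_collision t (n, n')).
apply: L2norm_le; first exact: sqrtr_ge0.
have tp := twopi_gt0 R; have vp := volume_gt0 R k.
have c0 : 0 <= 2 * A * (2 * pi) ^- 5.
  by rewrite mulr_ge0 ?mulr_ge0 ?invr_ge0 ?exprn_ge0// ltW.
rewrite sqr_sqrtr//.
have -> : energy (kernel_measure R k.+1) f = E0%:E.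
  rewrite /energy /E0 /Rintegral fineK//.
  by apply: integrable_fin_num => //; exact: memL2_integrable.
apply: le_trans FE _; rewrite -EFinM lee_fin le_eqVlt; apply/orP; left; apply/eqP.
rewrite /norm_const /B volumeS.
move: (2 * pi) (volume R k) tp vp => T W T0 W0.
by field; rewrite !gt_eqF.
Qed.

End assembly.

Local Close Scope complex_scope.
Local Close Scope classical_set_scope.

Theorem proposition3p1 :
  forall (R : realType) (alpha : R), 1 < alpha ->
  exists C1 : R, 0 < C1 /\
    forall gamma : (forall k : nat, kernel_fun R k), Hspace alpha gamma ->
    forall (k : nat) (j : 'I_k),
      (forall t : R, collision_summable j
         (free_evolution t (fourier (gamma k.+1)))) /\
      (L2norm_spacetime (fun t : R =>
         sobolev alpha (collision j
           (free_evolution t (fourier (gamma k.+1)))))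
       <= C1%:E * L2norm_coeff (sobolev alpha (fourier (gamma k.+1))))%E.
Proof.
move=> R al al1; have [A A0 gA] := gain_fiber_sum al1.
have A1 : 0 <= A + A + 1 by rewrite !addr_ge0.
pose C1 : R := Num.sqrt (2 * (A + A + 1) * (2 * pi) ^- 5).
have C10 : 0 < C1.
  rewrite sqrtr_gt0 mulr_gt0 ?invr_gt0 ?exprn_gt0 ?twopi_gt0//.
  by rewrite mulr_gt0// ltr_wpDl ?addr_ge0.
exists C1; split=> // gamma gH k j.
have [_ fin] := gH k.+1 isT.
set c := fourier (gamma k.+1) in fin *.
have gA1 y : sums_le _ (A + A + 1) := sums_le_weaken (ltac:(lra) : A + A <= A + A + 1) (gA k j y).
split=> [t|].
  have [_ [f [f2 fc] <-] _] := ereal_inf_lt fin.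
  have dB := sobolev_square_sum f2 fc.
  move=> n n'; split.
    have [C hC] := collision_term_sum al1 j dB true (n, n') t; exact: sums_le_csummable hC.
  have [C hC] := collision_term_sum al1 j dB false (n, n') t; exact: sums_le_csummable hC.
rewrite -lee_pdivrMl//; apply: le_ereal_inf_tmp => _ [f [f2 fc] <-].
rewrite lee_pdivrMl//.
exact: (spacetime_bound al1 A1 gA1 f2 fc).
Qed.
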